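(* Suppose that Assumptions (A1)–(A7) hold. Then there exists $\epsilon_0>0$ such that for every $\epsilon$ with $0<\epsilon<\epsilon_0$, Problem 1 (with this $\epsilon$) admits a solution $(u,m)$ with $u,m\in C^{2,\frac12}(\mathbb{T})$ and $m>0$ on $\mathbb{T}$.
   Context: Let $\mathbb{T}=\mathbb{R}/\mathbb{Z}$ be the one-dimensional torus; functions on $\mathbb{T}$ are identified with $1$-periodic functions on $\mathbb{R}$, and integrals over $\mathbb{T}$ are written $\int_0^1$. $C^{k,\frac12}(\mathbb{T})$ denotes the functions of class $C^k$ on $\mathbb{T}$ whose $k$-th derivative is $\frac12$-Hölder continuous. Let $H:\mathbb{R}\to\mathbb{R}$ be of class $C^2$, $V:\mathbb{T}\to\mathbb{R}$ continuous, $\alpha>0$, and $0<\epsilon\le 1$. We say $(u,m)$ solves Problem 1 if $u,m\in C^2(\mathbb{T})$, $m>0$ on $\mathbb{T}$, and on $\mathbb{T}$: $$u-u_{xx}+H(u_x)+V(x)=m^\alpha+\epsilon(m-m_{xx}),\qquad m-m_{xx}-(H'(u_x)m)_x=1-\epsilon(u-u_{xx}).$$ Assumptions: (A1) there exist constants $C_1,C_2,C_3>0$ and $\gamma>1$ such that $-C_1+C_2|p|^\gamma\le H(p)\le C_1+C_3|p|^\gamma$ for all $p\in\mathbb{R}$. (A2) There exist constants $\tilde C_1,\tilde C_2,\tilde C_3>0$ such that $-\tilde C_1+\tilde C_2|p|^\gamma\le pH'(p)-H(p)\le \tilde C_1+\tilde C_3|p|^\gamma$ for all $p$ (same $\gamma$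 as in (A1)). (A3) $V$ is of class $C^2$. (A4) $H$ is convex. (A5) $H$ is of class $C^4$. (A6) $\gamma<2$. (A7) There exists $\bar C>0$ with $|H'(p)|\le \bar C(1+|p|^{\gamma-1})$ for all $p$. *)

(* Defs.v *)
From Stdlib Require Import Reals Lra.
Open Scope R_scope.

(* Functions on the torus T = R/Z are 1-periodic functions on R. *)
Definition periodic1 (f : R -> R) : Prop := forall x, f (x + 1) = f x.

(* |p|^g with the convention 0^g = 0 (g > 0). *)
Definition powabs (p g : R) : R :=
  if Req_EM_T p 0 then 0 else Rpower (Rabs p) g.

Definition C2T (f f1 f2 : R -> R) : Prop :=
  periodic1 f /\
  (forall x, derivable_pt_lim f x (f1 x)) /\
  (forall x, derivable_pt_lim f1 x (f2 x)) /\
  (forall x, continuity_pt f2 x).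

Definition holder_half (g : R -> R) : Prop :=
  exists K, 0 <= K /\ forall x y, Rabs (g x - g y) <= K * sqrt (Rabs (x - y)).

Definition C2halfT (f f1 f2 : R -> R) : Prop :=
  C2T f f1 f2 /\ holder_half f2.

Definition C4R (H H1 H2 H3 H4 : R -> R) : Prop :=
  (forall p, derivable_pt_lim H p (H1 p)) /\
  (forall p, derivable_pt_lim H1 p (H2 p)) /\
  (forall p, derivable_pt_lim H2 p (H3 p)) /\
  (forall p, derivable_pt_lim H3 p (H4 p)) /\
  (forall p, continuity_pt H4 p).

Definition convex (H : R -> R) : Prop :=
  forall x y t, 0 <= t <= 1 ->
    H (t * x + (1 - t) * y) <= t * H x + (1 - t) * H y.

(* (u,m) solves Problem 1 with parameters H (H' = H1), V, alpha, eps,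
   where u1,u2 / m1,m2 are the first and second derivatives of u / m. *)
Definition Problem1 (H H1 V : R -> R) (alpha eps : R)
    (u u1 u2 m m1 m2 : R -> R) : Prop :=
  C2T u u1 u2 /\ C2T m m1 m2 /\ (forall x, 0 < m x) /\
  (forall x, u x - u2 x + H (u1 x) + V x
             = Rpower (m x) alpha + eps * (m x - m2 x)) /\
  exists w : R -> R,
    (forall x, derivable_pt_lim (fun y => H1 (u1 y) * m y) x (w x)) /\
    (forall x, m x - m2 x - w x = 1 - eps * (u x - u2 x)).

(* Main.v *)
From Stdlib Require Import Reals Lra Lia FunctionalExtensionality.
From Coquelicot Require Import Coquelicot.
Require Import Defs.
Open Scope R_scope.

(** The pair of equations is a monotone operator in [(m, u)], because [m H(p)] is convex in [p]
    and linear in [m], and the [eps]-terms make it strongly monotone in [H^1 x H^1].  Replacing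
    [H] and [V] by [lam H] and [lam V + (1 - lam)(1 + eps)] connects the problem, at [lam = 1],
    to one solved by [(u, m) = (0, 1)], at [lam = 0].  Near a solution with [m] bounded below and
    [u_x] bounded, the relaxation [z - tau (1 - d^2/dx^2)^{-1} A z] is a contraction, so a
    solution can be continued over a step in [lam] whose length depends only on those bounds.

    The bounds are uniform.  Testing the equations with [m], [u] and [1] bounds the [L^1] norms
    of [m^alpha], [lam H(u_x)] and [lam H'(u_x) m]; the Green function of [1 - d^2/dx^2] turns
    this into sup bounds on [u], [m], [u_x - eps m_x] and [m_x + eps u_x + lam H'(u_x) m].
    Eliminating [m_x] leaves [(1 + eps^2) u_x + eps lam m H'(u_x)] bounded, and as [H'] is
    nondecreasing this bounds [u_x] and then, after differentiation, [u_xx].  For small [eps] the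
    right-hand side [1 - eps (u - u_xx)] is thus at least [1/2], and the equation for [m] at a
    minimum of [m] gives a positive lower bound.  *)

(** * Calculus on the real line and on the torus *)

Definition has_derivative (f f' : R -> R) : Prop :=
  forall x, derivable_pt_lim f x (f' x).

Definition C0T (f : R -> R) : Prop := periodic1 f /\ continuity f.

Definition C1T (f f' : R -> R) : Prop :=
  periodic1 f /\ has_derivative f f' /\ continuity f'.

Lemma derivable_pt_lim_continuity_pt (f : R -> R) (x l : R) :
  derivable_pt_lim f x l -> continuity_pt f x.
Proof. intros Hf; apply derivable_continuous_pt; exists l; exact Hf. Qed.

Lemma has_derivative_continuity (f f' : R -> R) : has_derivative f f' -> continuity f.
Proof. intros Hf x; apply (derivable_pt_lim_continuity_pt f x (f' x)), Hf. Qed.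

Lemma continuity_pt_Rpower (f : R -> R) (a x : R) :
  continuity_pt f x -> 0 < f x -> continuity_pt (fun y => Rpower (f y) a) x.
Proof.
  intros Hf Hpos; apply (continuity_pt_comp f (fun t => Rpower t a)); [exact Hf|].
  eapply derivable_pt_lim_continuity_pt, derivable_pt_lim_power, Hpos.
Qed.

Ltac cont_step :=
  match goal with
  | |- continuity _ => intro
  | h : continuity_pt ?f ?x |- continuity_pt ?f ?x => exact h
  | h : continuity ?f |- continuity_pt ?f _ => apply h
  | h : forall i, continuity (?f i) |- continuity_pt (?f _) _ => apply h
  | h : C0T ?f |- continuity_pt ?f _ => apply h
  | h : has_derivative ?f _ |- continuity_pt ?f _ =>
      apply (has_derivative_continuity _ _ h)
  | h : C1T ?f _ |- continuity_pt ?f _ =>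
      apply (has_derivative_continuity _ _ (proj1 (proj2 h)))
  | h : C1T _ ?f' |- continuity_pt ?f' _ => apply (proj2 (proj2 h))
  | |- continuity_pt (fun _ => ?c) _ =>
      apply continuity_pt_const; intros ? ?; reflexivity
  | |- continuity_pt (fun x => x) _ => apply continuity_pt_id
  | |- continuity_pt (fun x => @?f x + @?g x) _ => apply (continuity_pt_plus f g)
  | |- continuity_pt (fun x => @?f x - @?g x) _ => apply (continuity_pt_minus f g)
  | |- continuity_pt (fun x => - @?f x) _ => apply (continuity_pt_opp f)
  | |- continuity_pt (fun x => @?f x * @?g x) _ => apply (continuity_pt_mult f g)
  | |- continuity_pt (fun x => @?f x / @?g x) _ => apply (continuity_pt_div f g)
  | |- continuity_pt (fun x => (@?f x) ^ 2) _ =>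
      apply (continuity_pt_mult f (fun x => f x * 1))
  | |- continuity_pt (fun x => Rabs (@?f x)) _ =>
      apply (continuity_pt_comp f Rabs); [|apply Rcontinuity_abs]
  | |- continuity_pt (fun x => exp (@?f x)) _ =>
      apply (continuity_pt_comp f exp);
        [|apply (has_derivative_continuity exp exp derivable_pt_lim_exp)]
  | |- continuity_pt (fun x => Rpower (@?f x) ?a) _ => apply (continuity_pt_Rpower f a)
  | |- continuity_pt (fun x => ?k (@?f x)) _ => apply (continuity_pt_comp f k)
  end.
Ltac cont := repeat (cont_step; cbv beta).

Ltac derive_step :=
  match goal with
  | h : has_derivative ?f _ |- derivable_pt_lim ?f _ _ => apply h
  | h : C1T ?f _ |- derivable_pt_lim ?f _ _ => apply (proj1 (proj2 h))
  | h : derivable_pt_lim ?f ?x _ |- derivable_pt_lim ?f ?x _ => exact h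
  | |- derivable_pt_lim (fun _ => ?c) _ _ => apply (derivable_pt_lim_const c)
  | |- derivable_pt_lim (fun y => y) _ _ => apply derivable_pt_lim_id
  | |- derivable_pt_lim (fun y => @?f y + @?g y) _ _ => apply (derivable_pt_lim_plus f g)
  | |- derivable_pt_lim (fun y => @?f y - @?g y) _ _ => apply (derivable_pt_lim_minus f g)
  | |- derivable_pt_lim (fun y => - @?f y) _ _ => apply (derivable_pt_lim_opp f)
  | |- derivable_pt_lim (fun y => @?f y * @?g y) _ _ => apply (derivable_pt_lim_mult f g)
  | |- derivable_pt_lim (fun y => @?f y / ?c) _ _ => apply (derivable_pt_lim_div_scal f)
  | |- derivable_pt_lim (fun y => exp (@?f y)) _ _ =>
      apply (derivable_pt_lim_comp f exp); [|apply derivable_pt_lim_exp]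
  | |- derivable_pt_lim (fun y => ?k (@?f y)) _ _ => apply (derivable_pt_lim_comp f k)
  end.
Ltac derive :=
  match goal with
  |- derivable_pt_lim ?f ?x ?l =>
      refine (eq_ind _ (derivable_pt_lim f x) _ l _);
        [repeat (derive_step; cbv beta) | cbv beta]
  end.

Lemma Rabs_unit_mult_le (t a b : R) : 0 <= t <= 1 -> Rabs a <= b -> Rabs (t * a) <= b.
Proof.
  intros Ht Ha; rewrite Rabs_mult, (Rabs_pos_eq t) by lra.
  assert (Hpos := Rabs_pos a); nra.
Qed.

Lemma rotation_scaling_bound (eps a b s t : R) : 0 <= eps <= 1 ->
  Rabs (a - eps * b) <= s -> Rabs (b + eps * a) <= t -> Rabs a <= s + t /\ Rabs b <= s + t.
Proof.
  intros Heps Hs Ht.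
  assert (Hdiv : forall y r, Rabs ((1 + eps ^ 2) * y) <= r -> Rabs y <= r).
  { intros y r; rewrite Rabs_mult, (Rabs_pos_eq (1 + eps ^ 2)) by nra.
    assert (Hpos := Rabs_pos y); nra. }
  assert (Hs' := Rabs_unit_mult_le eps _ _ Heps Hs).
  assert (Ht' := Rabs_unit_mult_le eps _ _ Heps Ht).
  apply Rabs_le_between in Hs, Ht, Hs', Ht'.
  split; apply Hdiv, Rabs_le_between; lra.
Qed.

Lemma monotone_equation_bound (f : R -> R) (a g p y : R) :
  (forall s t, 0 <= (f s - f t) * (s - t)) -> 1 <= a -> 0 <= g ->
  a * p + g * f p = y -> Rabs p <= Rabs y + g * Rabs (f 0).
Proof.
  intros Hmono Ha Hg Heq; set (rhs := y - g * f 0).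
  assert (Hrhs : Rabs rhs <= Rabs y + g * Rabs (f 0)).
  { unfold rhs; eapply Rle_trans; [apply Rabs_triang|].
    rewrite Rabs_Ropp, Rabs_mult, (Rabs_pos_eq g) by lra; lra. }
  apply Rle_trans with (Rabs rhs); [|exact Hrhs].
  apply Rsqr_le_abs_0; unfold Rsqr.
  specialize (Hmono p 0); rewrite Rminus_0_r in Hmono.
  assert (Hp : p * p <= p * rhs).
  { unfold rhs; rewrite <- Heq.
    assert (0 <= g * ((f p - f 0) * p)) by (apply Rmult_le_pos; lra); nra. }
  assert (Hsq := pow2_ge_0 (rhs - p)); lra.
Qed.

Lemma continuity_bounded_on (f : R -> R) (a b : R) :
  (forall x, a <= x <= b -> continuity_pt f x) ->
  exists K, 0 <= K /\ forall x, a <= x <= b -> Rabs (f x) <= K.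
Proof.
  intros Hf; destruct (Rle_lt_dec a b) as [Hab|Hab].
  - destruct (continuity_ab_maj (fun x => Rabs (f x)) a b Hab) as [xmax [Hmax _]].
    { intros c Hc; specialize (Hf c Hc); cont. }
    exists (Rabs (f xmax)); split; [apply Rabs_pos | exact Hmax].
  - exists 0; split; [lra | intros x Hx; lra].
Qed.

Lemma lipschitz_on (f f' : R -> R) (a b : R) :
  (forall x, a <= x <= b -> derivable_pt_lim f x (f' x)) ->
  (forall x, a <= x <= b -> continuity_pt f' x) ->
  exists L, 0 <= L /\ forall x y, a <= x <= b -> a <= y <= b ->
    Rabs (f x - f y) <= L * Rabs (x - y).
Proof.
  intros Hf Hf'; destruct (continuity_bounded_on f' a b Hf') as [L [HL Hbound]].
  exists L; split; [exact HL | intros x y Hx Hy].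
  assert (Hin : forall c, Rmin y x <= c <= Rmax y x -> a <= c <= b).
  { intros c; unfold Rmin, Rmax; destruct (Rle_dec y x); lra. }
  destruct (MVT_abs f f' y x) as [c [-> Hc]]; [intros c Hc; apply Hf, Hin, Hc|].
  apply Rmult_le_compat_r; [apply Rabs_pos | apply Hbound, Hin, Hc].
Qed.

Lemma Rpower_mono (a x y : R) : 0 <= a -> 0 < x -> 0 < y ->
  0 <= (Rpower x a - Rpower y a) * (x - y).
Proof.
  intros Ha Hx Hy; destruct (Rle_lt_dec x y) as [Hxy|Hxy].
  - assert (Rpower x a <= Rpower y a) by (apply Rle_Rpower_l; lra); nra.
  - assert (Rpower y a <= Rpower x a) by (apply Rle_Rpower_l; lra); nra.
Qed.

Lemma Rpower_lipschitz_on (alpha a b : R) : 0 < a ->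
  exists L, 0 <= L /\ forall x y, a <= x <= b -> a <= y <= b ->
    Rabs (Rpower x alpha - Rpower y alpha) <= L * Rabs (x - y).
Proof.
  intros Ha.
  apply (lipschitz_on (fun x => Rpower x alpha) (fun x => alpha * Rpower x (alpha - 1)));
    intros x Hx; [apply derivable_pt_lim_power | cont]; lra.
Qed.

Lemma Rpower_absorb (alpha c : R) : 0 < alpha -> 0 <= c -> exists K, 0 <= K /\ forall m, 0 < m ->
  Rpower m alpha + c * m <= / 2 * (Rpower m alpha * m) + K.
Proof.
  intros Halpha Hc; set (B := Rmax 4 (Rpower (4 * c + 1) (/ alpha))).
  assert (HB4 : 4 <= B) by apply Rmax_l.
  assert (HBc : 4 * c <= Rpower B alpha).
  { apply Rle_trans with (Rpower (Rpower (4 * c + 1) (/ alpha)) alpha).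
    - rewrite Rpower_mult, Rinv_l, Rpower_1; lra.
    - apply Rle_Rpower_l; [lra | split; [apply exp_pos | apply Rmax_r]]. }
  assert (HcB : 0 <= c * B) by (apply Rmult_le_pos; lra).
  exists (Rpower B alpha + c * B); split; [lra | intros m Hm].
  assert (Hpos : 0 < Rpower m alpha) by apply exp_pos.
  assert (Hpos' : 0 <= Rpower m alpha * m) by (apply Rmult_le_pos; lra).
  destruct (Rle_lt_dec B m) as [HBm|HmB].
  - assert (Rpower B alpha <= Rpower m alpha) by (apply Rle_Rpower_l; lra).
    assert (4 * Rpower m alpha <= Rpower m alpha * m) by nra.
    assert (4 * c * m <= Rpower m alpha * m) by (apply Rmult_le_compat_r; lra); lra.
  - assert (Rpower m alpha <= Rpower B alpha) by (apply Rle_Rpower_l; lra).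
    assert (c * m <= c * B) by (apply Rmult_le_compat_l; lra); lra.
Qed.

Lemma Rpower_le_1_plus (alpha m : R) : 0 <= alpha -> 0 < m ->
  Rpower m alpha <= 1 + Rpower m alpha * m.
Proof.
  intros Halpha Hm; assert (Hpos : 0 < Rpower m alpha) by apply exp_pos.
  assert (Hpos' : 0 < Rpower m alpha * m) by (apply Rmult_lt_0_compat; lra).
  destruct (Rle_lt_dec 1 m) as [H1m|Hm1]; [nra|].
  assert (Hle : Rpower m alpha <= Rpower 1 alpha) by (apply Rle_Rpower_l; lra).
  replace (Rpower 1 alpha) with 1 in Hle
    by (unfold Rpower; rewrite ln_1, Rmult_0_r, exp_0; reflexivity).
  lra.
Qed.

Lemma derivable_pt_lim_at_min (f : R -> R) (x0 l : R) :
  (forall x, f x0 <= f x) -> derivable_pt_lim f x0 l -> l = 0.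
Proof.
  intros Hmin Hf.
  assert (pr : derivable_pt f x0) by (exists l; exact Hf).
  rewrite <- (derive_pt_eq_0 f x0 l pr Hf).
  apply (deriv_minimum f (x0 - 1) (x0 + 1) x0 pr); try lra.
  intros y _ _; apply Hmin.
Qed.

Lemma derivable_pt_lim_nonneg (f : R -> R) (x0 l : R) :
  (forall eta, 0 < eta -> exists y, x0 < y < x0 + eta /\ f x0 <= f y) ->
  derivable_pt_lim f x0 l -> 0 <= l.
Proof.
  intros Hright Hf; destruct (Rle_lt_dec 0 l) as [|Hl]; [assumption|exfalso].
  destruct (Hf (- l) ltac:(lra)) as [d Hd].
  destruct (Hright d (cond_pos d)) as [y [Hy Hfy]].
  specialize (Hd (y - x0)).
  replace (x0 + (y - x0)) with y in Hd by ring.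
  rewrite (Rabs_pos_eq (y - x0)) in Hd by lra.
  specialize (Hd ltac:(lra) ltac:(lra)); apply Rabs_def2 in Hd.
  assert (0 <= (f y - f x0) / (y - x0)) by (apply Rle_div_r; lra); lra.
Qed.

Lemma derivable_pt_lim2_at_min (f f' : R -> R) (x0 l : R) :
  (forall x, f x0 <= f x) -> has_derivative f f' -> derivable_pt_lim f' x0 l -> 0 <= l.
Proof.
  intros Hmin Hf; apply derivable_pt_lim_nonneg; intros eta Heta.
  destruct (MVT_cor2 f f' x0 (x0 + eta / 2)) as [c [Hc Hxc]]; [lra | intros; apply Hf|].
  exists c; split; [lra|].
  rewrite (derivable_pt_lim_at_min f x0 (f' x0) Hmin (Hf x0)).
  specialize (Hmin (x0 + eta / 2)); nra.
Qed.

Lemma monotone_derivative_nonneg (f : R -> R) (x l : R) :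
  (forall s t, 0 <= (f s - f t) * (s - t)) -> derivable_pt_lim f x l -> 0 <= l.
Proof.
  intros Hmono; apply derivable_pt_lim_nonneg; intros eta Heta.
  exists (x + eta / 2); split; [lra|]; specialize (Hmono (x + eta / 2) x); nra.
Qed.

Lemma convex_tangent (f f' : R -> R) : convex f -> has_derivative f f' ->
  forall x y, f x + f' x * (y - x) <= f y.
Proof.
  intros Hconv Hf x y.
  set (gap := fun t => f x + t * (f y - f x) - f (x + t * (y - x))).
  assert (Hgap : derivable_pt_lim gap 0 ((f y - f x) - f' x * (y - x))).
  { unfold gap; derive; replace (x + 0 * (y - x)) with x by ring; ring. }
  assert (Hgap0 : gap 0 = 0) by (unfold gap; rewrite !Rmult_0_l, !Rplus_0_r; ring).
  apply derivable_pt_lim_nonneg in Hgap; [lra|].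
  intros eta Heta; set (t := Rmin (eta / 2) 1).
  assert (Ht : 0 < t) by (apply Rmin_glb_lt; lra).
  assert (Ht1 : t <= eta / 2) by apply Rmin_l; assert (Ht2 : t <= 1) by apply Rmin_r.
  exists t; split; [lra|]; rewrite Hgap0; unfold gap.
  assert (Hchord := Hconv y x t ltac:(lra)).
  replace (t * y + (1 - t) * x) with (x + t * (y - x)) in Hchord by ring; lra.
Qed.

Lemma periodic1_shift_Z (f : R -> R) (k : Z) (x : R) :
  periodic1 f -> f (x + IZR k) = f x.
Proof.
  intros Hf; revert k; apply Z.peano_ind; [f_equal; ring| |].
  - intros k <-; rewrite succ_IZR, <- Rplus_assoc; apply Hf.
  - intros k <-; rewrite <- Hf, <- Z.sub_1_r, minus_IZR; f_equal; ring.
Qed.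

Lemma unit_interval_representative (x : R) :
  exists y, 0 <= y <= 1 /\ forall f, periodic1 f -> f x = f y.
Proof.
  destruct (archimed x) as [Ha Hb].
  exists (x - IZR (up x) + 1); split; [lra|]; intros f Hf.
  rewrite <- (periodic1_shift_Z f (1 - up x) x Hf), minus_IZR; f_equal; ring.
Qed.

Lemma C0T_bounded (f : R -> R) : C0T f -> exists K, 0 <= K /\ forall x, Rabs (f x) <= K.
Proof.
  intros [Hper Hf]; destruct (continuity_bounded_on f 0 1 (fun x _ => Hf x)) as [K [HK Hbound]].
  exists K; split; [exact HK | intros x].
  destruct (unit_interval_representative x) as [y [Hy ->]]; [apply Hbound, Hy | exact Hper].
Qed.

Lemma C0T_min_attained (f : R -> R) : C0T f -> exists x0, forall x, f x0 <= f x.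
Proof.
  intros [Hper Hf].
  destruct (continuity_ab_min f 0 1) as [x0 [Hmin _]]; [lra | intros; apply Hf |].
  exists x0; intros x; destruct (unit_interval_representative x) as [y [Hy Heq]].
  rewrite (Heq f Hper); apply Hmin, Hy.
Qed.

Lemma C1T_C0T (f f' : R -> R) : C1T f f' -> C0T f.
Proof. intros Hf; split; [apply Hf | cont]. Qed.

Lemma C1T_derivative (f f' : R -> R) : C1T f f' -> C0T f'.
Proof.
  intros [Hper [Hf Hf']]; split; [intros x | exact Hf'].
  apply (uniqueness_limite f x); [|apply Hf].
  apply (derivable_pt_lim_ext (fun y => f (y + 1))); [exact Hper|]; derive; ring.
Qed.

Ltac periodic :=
  let x := fresh "x" in
  intros x; repeat match goal with
  | h : periodic1 ?f |- context [?f (x + 1)] => rewrite (h x)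
  | h : C0T ?f |- context [?f (x + 1)] => rewrite (proj1 h x)
  | h : C1T ?f _ |- context [?f (x + 1)] => rewrite (proj1 h x)
  | h : C1T _ ?f |- context [?f (x + 1)] => rewrite (proj1 (C1T_derivative _ _ h) x)
  end; reflexivity.
Ltac torus := split; [periodic | cont].

Lemma C1T_minus (f f' g g' : R -> R) : C1T f f' -> C1T g g' ->
  C1T (fun x => f x - g x) (fun x => f' x - g' x).
Proof.
  intros Hf Hg; split; [periodic | split; [intros x; derive; reflexivity | cont]].
Qed.

Definition C1R (f : R -> R) : Prop := exists f', has_derivative f f' /\ continuity f'.

Lemma C1R_const (c : R) : C1R (fun _ => c).
Proof. exists (fun _ => 0); split; [intros x; derive; reflexivity | cont]. Qed.

Lemma C1R_plus (f g : R -> R) : C1R f -> C1R g -> C1R (fun x => f x + g x).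
Proof.
  intros [f' [Df Cf]] [g' [Dg Cg]]; exists (fun x => f' x + g' x).
  split; [intros x; derive; reflexivity | cont].
Qed.

Lemma C1R_minus (f g : R -> R) : C1R f -> C1R g -> C1R (fun x => f x - g x).
Proof.
  intros [f' [Df Cf]] [g' [Dg Cg]]; exists (fun x => f' x - g' x).
  split; [intros x; derive; reflexivity | cont].
Qed.

Lemma C1R_mult (f g : R -> R) : C1R f -> C1R g -> C1R (fun x => f x * g x).
Proof.
  intros [f' [Df Cf]] [g' [Dg Cg]]; exists (fun x => f' x * g x + f x * g' x).
  split; [intros x; derive; reflexivity | cont].
Qed.

Lemma C1R_div (f g : R -> R) : C1R f -> C1R g -> (forall x, g x <> 0) -> C1R (fun x => f x / g x).
Proof.
  intros [f' [Df Cf]] [g' [Dg Cg]] Hg; exists (fun x => (f' x * g x - g' x * f x) / (g x)²).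
  split.
  - intros x; apply (derivable_pt_lim_div f g); [apply Df | apply Dg | apply Hg].
  - unfold Rsqr; cont; apply Rmult_integral_contrapositive_currified; apply Hg.
Qed.

Lemma C1R_comp (f g : R -> R) : C1R f -> C1R g -> C1R (fun x => f (g x)).
Proof.
  intros [f' [Df Cf]] [g' [Dg Cg]]; exists (fun x => f' (g x) * g' x).
  split; [intros x; derive; reflexivity | cont].
Qed.

Lemma C1R_Rpower (f : R -> R) (a : R) : C1R f -> (forall x, 0 < f x) ->
  C1R (fun x => Rpower (f x) a).
Proof.
  intros [f' [Df Cf]] Hpos; exists (fun x => a * Rpower (f x) (a - 1) * f' x); split.
  - intros x; apply (derivable_pt_lim_comp f (fun t => Rpower t a)); [apply Df|].
    apply derivable_pt_lim_power, Hpos.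
  - cont; apply Hpos.
Qed.

Lemma C1T_C1R (f f' : R -> R) : C1T f f' -> C1R f.
Proof. intros [_ Hf]; exists f'; exact Hf. Qed.

Ltac C1_regular :=
  repeat match goal with
  | h : C1R ?f |- C1R ?f => exact h
  | h : C1T ?f _ |- C1R ?f => exact (C1T_C1R _ _ h)
  | |- C1R (fun _ => ?c) => apply (C1R_const c)
  | |- C1R (fun x => @?f x + @?g x) => apply (C1R_plus f g)
  | |- C1R (fun x => @?f x - @?g x) => apply (C1R_minus f g)
  | |- C1R (fun x => @?f x * @?g x) => apply (C1R_mult f g)
  | |- C1R (fun x => @?f x / @?g x) => apply (C1R_div f g)
  | |- C1R (fun x => Rpower (@?f x) ?a) => apply (C1R_Rpower f a)
  | |- C1R (fun x => ?k (@?f x)) => apply (C1R_comp k f)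
  end.

Lemma C1T_holder_half (f f' : R -> R) : C1T f f' -> holder_half f.
Proof.
  intros Hf.
  destruct (C0T_bounded f (C1T_C0T _ _ Hf)) as [K [HK Bf]].
  destruct (C0T_bounded f' (C1T_derivative _ _ Hf)) as [K' [HK' Bf']].
  exists (K' + 2 * K); split; [lra | intros x y].
  assert (Hlip : Rabs (f x - f y) <= K' * Rabs (x - y)).
  { destruct (MVT_abs f f' y x) as [c [-> _]]; [intros; apply Hf|].
    apply Rmult_le_compat_r; [apply Rabs_pos | apply Bf']. }
  assert (Hosc : Rabs (f x - f y) <= 2 * K).
  { assert (Bx := Bf x); assert (By := Bf y); apply Rabs_le_between in Bx, By.
    apply Rabs_le_between; lra. }
  set (d := Rabs (x - y)) in *; assert (Hd : 0 <= d) by apply Rabs_pos.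
  assert (Hs := sqrt_pos d); assert (Hss := sqrt_sqrt d Hd).
  destruct (Rle_lt_dec (sqrt d) 1) as [Hd1|Hd1].
  - assert (K' * d <= K' * sqrt d) by (apply Rmult_le_compat_l; nra).
    assert (0 <= 2 * K * sqrt d) by (apply Rmult_le_pos; lra); lra.
  - assert (2 * K * 1 <= 2 * K * sqrt d) by (apply Rmult_le_compat_l; lra).
    assert (0 <= K' * sqrt d) by (apply Rmult_le_pos; lra); lra.
Qed.

Lemma C2halfT_of_C1R (f f1 f2 : R -> R) : C1T f f1 -> C1T f1 f2 -> C1R f2 -> C2halfT f f1 f2.
Proof.
  intros Hf Hf1 [f3 Hf2]; split.
  - split; [apply Hf | split; [apply Hf | apply Hf1]].
  - apply (C1T_holder_half f2 f3); split; [apply (C1T_derivative f1), Hf1 | exact Hf2].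
Qed.

(** * Mean value over a period *)

Definition mean (f : R -> R) : R := RInt f 0 1.

Lemma continuity_ex_RInt (f : R -> R) (a b : R) : continuity f -> ex_RInt f a b.
Proof.
  intros Hf; apply (ex_RInt_continuous f); intros z _; apply continuity_pt_filterlim, Hf.
Qed.

Lemma RInt_derivative (f f' : R -> R) (a b : R) : has_derivative f f' -> continuity f' ->
  RInt f' a b = f b - f a.
Proof.
  intros Hf Hf'; apply is_RInt_unique, (is_RInt_derive f f'); intros x _.
  - apply is_derive_Reals, Hf.
  - apply continuity_pt_filterlim, Hf'.
Qed.

Lemma RInt_has_derivative (f : R -> R) (a : R) : continuity f ->
  has_derivative (fun x => RInt f a x) f.
Proof.
  intros Hf x; apply is_derive_Reals, (is_derive_RInt f _ a).
  - apply filter_forall; intros b; apply (RInt_correct f), continuity_ex_RInt, Hf.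
  - apply continuity_pt_filterlim, Hf.
Qed.

Lemma RInt_Chasles_minus (f : R -> R) (a b c : R) : continuity f ->
  RInt f b c = RInt f a c - RInt f a b.
Proof.
  intros Hf.
  assert (Hsum := RInt_Chasles f a b c (continuity_ex_RInt f _ _ Hf) (continuity_ex_RInt f _ _ Hf)).
  unfold plus in Hsum; simpl in Hsum; lra.
Qed.

Lemma RInt_mult_l (c : R) (f : R -> R) (a b : R) : continuity f ->
  RInt (fun x => c * f x) a b = c * RInt f a b.
Proof. intros Hf; apply (RInt_scal f), continuity_ex_RInt, Hf. Qed.

Lemma RInt_shift (f : R -> R) (a b c : R) : continuity f ->
  RInt (fun y => f (y + c)) a b = RInt f (a + c) (b + c).
Proof.
  intros Hf; replace (a + c) with (1 * a + c) by ring; replace (b + c) with (1 * b + c) by ring.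
  rewrite <- (RInt_comp_lin f 1 c a b) by (apply continuity_ex_RInt, Hf).
  apply RInt_ext; intros x _; unfold scal; simpl; unfold mult; simpl.
  rewrite !Rmult_1_l; reflexivity.
Qed.

Lemma RInt_period (f : R -> R) (x : R) : C0T f -> RInt f x (x + 1) = mean f.
Proof.
  intros [Hper Hf]; assert (Hshift := RInt_shift f 0 x 1 Hf).
  rewrite (RInt_ext _ f), Rplus_0_l in Hshift by (intros y _; apply Hper).
  rewrite (RInt_Chasles_minus f 0 1) in Hshift by exact Hf.
  rewrite (RInt_Chasles_minus f 0 x) by exact Hf; unfold mean; lra.
Qed.

Lemma mean_plus (f g : R -> R) : continuity f -> continuity g ->
  mean (fun x => f x + g x) = mean f + mean g.
Proof. intros Hf Hg; apply (RInt_plus f g); apply continuity_ex_RInt; assumption. Qed.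

Lemma mean_mult_l (c : R) (f : R -> R) : continuity f ->
  mean (fun x => c * f x) = c * mean f.
Proof. exact (RInt_mult_l c f 0 1). Qed.

Lemma mean_const (c : R) : mean (fun _ => c) = c.
Proof. unfold mean; rewrite RInt_const; unfold scal; simpl; unfold mult; simpl; ring. Qed.

Lemma mean_ext (f g : R -> R) : (forall x, f x = g x) -> mean f = mean g.
Proof. intros Hfg; apply RInt_ext; intros x _; apply Hfg. Qed.

Lemma mean_le (f g : R -> R) : continuity f -> continuity g ->
  (forall x, f x <= g x) -> mean f <= mean g.
Proof.
  intros Hf Hg Hfg; apply RInt_le; try (apply continuity_ex_RInt; assumption); [lra|].
  intros x _; apply Hfg.
Qed.

Lemma mean_le_const (f : R -> R) (K : R) : continuity f -> (forall x, f x <= K) -> mean f <= K.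
Proof. intros Hf HK; rewrite <- (mean_const K); apply mean_le; [cont | cont | exact HK]. Qed.

Lemma mean_nonneg (f : R -> R) : continuity f -> (forall x, 0 <= f x) -> 0 <= mean f.
Proof. intros Hf H0; rewrite <- (mean_const 0); apply mean_le; [cont | cont | exact H0]. Qed.

Lemma mean_derivative (f f' : R -> R) : C1T f f' -> mean f' = 0.
Proof.
  intros [Hper [Hf Hf']]; unfold mean; rewrite (RInt_derivative f f' 0 1 Hf Hf').
  rewrite <- (Hper 0), Rplus_0_l; ring.
Qed.

Lemma mean_parts (f f' g g' : R -> R) : C1T f f' -> C1T g g' ->
  mean (fun x => f' x * g x + f x * g' x) = 0.
Proof.
  intros Hf Hg; apply (mean_derivative (fun x => f x * g x)).
  split; [periodic | split; [intros x; derive; reflexivity | cont]].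
Qed.

Lemma mean_abs_sq (f : R -> R) : continuity f ->
  mean (fun x => Rabs (f x)) ^ 2 <= mean (fun x => f x ^ 2).
Proof.
  intros Hf; set (c := mean (fun x => Rabs (f x))).
  assert (Hle : mean (fun x => 2 * c * Rabs (f x) + - c ^ 2) <= mean (fun x => f x ^ 2)).
  { apply mean_le; [cont | cont |]; intros x.
    rewrite <- (pow2_abs (f x)); assert (Hsq := pow2_ge_0 (Rabs (f x) - c)); lra. }
  rewrite mean_plus, mean_mult_l, mean_const in Hle by cont; fold c in Hle; lra.
Qed.

(** * The operator [1 - d^2/dx^2] on the torus *)

(* The periodic solution of [a - a' / k = f]. *)
Definition resolvent (k : R) (f : R -> R) (x : R) : R :=
  k * exp (k * x) * RInt (fun y => exp (- (k * y)) * f y) x (x + 1) / (1 - exp (- k)).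

Lemma one_minus_exp_neq_0 (k : R) : k <> 0 -> 1 - exp k <> 0.
Proof. intros Hk Hexp; apply Hk, exp_inv; rewrite exp_0; lra. Qed.

Lemma resolvent_periodic (k : R) (f : R -> R) : C0T f -> periodic1 (resolvent k f).
Proof.
  intros Hf x; unfold resolvent.
  rewrite <- (RInt_shift (fun y => exp (- (k * y)) * f y) x (x + 1) 1) by cont.
  rewrite (RInt_ext _ (fun y => exp (- k) * (exp (- (k * y)) * f y))).
  - rewrite RInt_mult_l by cont.
    replace (exp (k * (x + 1))) with (exp (k * x) * exp k)
      by (rewrite <- exp_plus; f_equal; ring).
    assert (Hexp : exp k * exp (- k) = 1)
      by (rewrite <- exp_plus, Rplus_opp_r, exp_0; reflexivity).
    set (I := RInt _ x (x + 1)).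
    replace (k * (exp (k * x) * exp k) * (exp (- k) * I))
      with (k * exp (k * x) * I * (exp k * exp (- k))) by ring.
    rewrite Hexp, Rmult_1_r; reflexivity.
  - intros y _; rewrite (proj1 Hf), <- Rmult_assoc, <- exp_plus; do 2 f_equal; ring.
Qed.

Lemma resolvent_has_derivative (k : R) (f : R -> R) : k <> 0 -> C0T f ->
  has_derivative (resolvent k f) (fun x => k * (resolvent k f x - f x)).
Proof.
  intros Hk Hf x; assert (Hne := one_minus_exp_neq_0 (- k) ltac:(lra)).
  set (g := fun y => exp (- (k * y)) * f y); assert (Hg : continuity g) by (unfold g; cont).
  set (P := fun x => RInt g 0 x).
  assert (HP : has_derivative P g) by (apply RInt_has_derivative, Hg).
  assert (Hres : forall y, resolvent k f y
    = k * exp (k * y) * (P (y + 1) - P y) / (1 - exp (- k))).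
  { intros y; unfold resolvent; fold g; rewrite (RInt_Chasles_minus g 0) by exact Hg; reflexivity. }
  apply (derivable_pt_lim_ext
    (fun y => k * exp (k * y) * (P (y + 1) - P y) / (1 - exp (- k)))).
  { intros y; symmetry; apply Hres. }
  derive; rewrite Hres; unfold g; rewrite (proj1 Hf).
  replace (exp (- (k * (x + 1)))) with (exp (- (k * x)) * exp (- k))
    by (rewrite <- exp_plus; f_equal; ring).
  rewrite (exp_Ropp (k * x)); field; split; [exact Hne | apply Rgt_not_eq, exp_pos].
Qed.

Lemma resolvent_equation_bound (k : R) (a f : R -> R) : periodic1 a -> C0T f ->
  has_derivative a (fun x => k * (a x - f x)) ->
  forall x, Rabs (1 - exp (- k)) * Rabs (a x)
    <= Rabs k * (1 + exp (- k)) * mean (fun y => Rabs (f y)).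
Proof.
  intros Hper Hf Ha x; set (w := exp (- (k * x))).
  assert (Hw : 0 < w) by apply exp_pos.
  assert (Hshift : exp (- (k * (x + 1))) = w * exp (- k)).
  { unfold w; rewrite <- exp_plus; f_equal; ring. }
  assert (Hint : - k * RInt (fun y => exp (- (k * y)) * f y) x (x + 1)
                 = - (w * (1 - exp (- k)) * a x)).
  { rewrite <- RInt_mult_l by cont.
    rewrite (RInt_derivative (fun y => exp (- (k * y)) * a y)).
    - rewrite Hper, Hshift; unfold w; ring.
    - intros y; derive; ring.
    - cont. }
  assert (Hbound : Rabs (RInt (fun y => exp (- (k * y)) * f y) x (x + 1))
                   <= w * (1 + exp (- k)) * mean (fun y => Rabs (f y))).
  { eapply Rle_trans; [apply abs_RInt_le; [lra | apply continuity_ex_RInt; cont]|].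
    rewrite <- (RInt_period (fun y => Rabs (f y)) x) by torus.
    rewrite <- RInt_mult_l by cont.
    apply RInt_le; [lra | apply continuity_ex_RInt; cont | apply continuity_ex_RInt; cont |].
    intros y Hy; rewrite Rabs_mult, (Rabs_pos_eq (exp _)) by (left; apply exp_pos).
    apply Rmult_le_compat_r; [apply Rabs_pos|].
    rewrite Rmult_plus_distr_l, Rmult_1_r, <- Hshift; unfold w.
    assert (Hleft := exp_pos (- (k * x))); assert (Hright := exp_pos (- (k * (x + 1)))).
    destruct (Rtotal_order k 0) as [Hneg | [-> | Hpos]].
    - assert (exp (- (k * y)) < exp (- (k * (x + 1)))) by (apply exp_increasing; nra); lra.
    - rewrite !Rmult_0_l in *; lra.
    - assert (exp (- (k * y)) < exp (- (k * x))) by (apply exp_increasing; nra); lra. }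
  apply (f_equal Rabs) in Hint; rewrite Rabs_Ropp, !Rabs_mult, Rabs_Ropp in Hint.
  rewrite (Rabs_pos_eq w) in Hint by lra.
  apply (Rmult_le_compat_l (Rabs k)) in Hbound; [|apply Rabs_pos].
  rewrite Hint in Hbound; apply (Rmult_le_reg_l w); [exact Hw | lra].
Qed.

Lemma unit_resolvent_equation_bound (k : R) (a f : R -> R) : k = 1 \/ k = -1 ->
  periodic1 a -> C0T f -> has_derivative a (fun x => k * (a x - f x)) ->
  forall x, Rabs (a x) <= 3 * mean (fun y => Rabs (f y)).
Proof.
  intros Hk Hper Hf Ha x; assert (Hbound := resolvent_equation_bound k a f Hper Hf Ha x).
  assert (Hmean : 0 <= mean (fun y => Rabs (f y)))
    by (apply mean_nonneg; [cont | intros; apply Rabs_pos]).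
  assert (He := exp_ineq1 1 ltac:(lra)).
  destruct Hk as [-> | ->].
  - assert (Hinv : exp (- (1)) < / 2) by (rewrite exp_Ropp; apply Rinv_lt_contravar; lra).
    rewrite (Rabs_pos_eq (1 - _)), Rabs_R1 in Hbound by lra; nra.
  - replace (- -1) with 1 in Hbound by ring.
    rewrite (Rabs_left (1 - exp 1)), (Rabs_left (-1)) in Hbound by lra; nra.
Qed.

Lemma sobolev (v v' : R -> R) : C1T v v' ->
  forall x, v x ^ 2 <= 9 * mean (fun y => v y ^ 2 + v' y ^ 2).
Proof.
  intros Hv x; set (f := fun y => v y - v' y).
  assert (Hf : C0T f) by (unfold f; torus).
  assert (Hbound : Rabs (v x) <= 3 * mean (fun y => Rabs (f y))).
  { apply (unit_resolvent_equation_bound 1 v f); [left; reflexivity | apply Hv | exact Hf|].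
    intros y; unfold f; derive; ring. }
  assert (Hsplit : mean (fun y => f y ^ 2) = mean (fun y => v y ^ 2 + v' y ^ 2)).
  { rewrite <- (Rplus_0_r (mean _)), <- (mean_parts v v' v v' Hv Hv), <- mean_plus
      by (unfold f; cont).
    apply mean_ext; intros y; unfold f; ring. }
  assert (Hsq := mean_abs_sq f (proj2 Hf)); rewrite Hsplit in Hsq.
  apply (pow_maj_Rabs _ _ 2) in Hbound; lra.
Qed.

(* [helmholtz f v v'] says that [v - v'' = f], in the weak sense that only [v'] is required to
   be differentiable. *)
Definition helmholtz (f v v' : R -> R) : Prop :=
  C1T v v' /\ C1T v' (fun x => v x - f x).

Definition green (f : R -> R) (x : R) : R := (resolvent 1 f x + resolvent (-1) f x) / 2.
Definition green' (f : R -> R) (x : R) : R := (resolvent 1 f x - resolvent (-1) f x) / 2.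

(* [1 - d^2 = (1 - d) (1 + d)], and the two factors are inverted by [resolvent 1] and
   [resolvent (-1)]. *)
Lemma green_helmholtz (f : R -> R) : C0T f -> helmholtz f (green f) (green' f).
Proof.
  intros Hf.
  assert (Hder := resolvent_has_derivative 1 f ltac:(lra) Hf).
  assert (Hder' := resolvent_has_derivative (-1) f ltac:(lra) Hf).
  assert (Hper := resolvent_periodic 1 f Hf); assert (Hper' := resolvent_periodic (-1) f Hf).
  unfold helmholtz, green, green'; repeat split; try periodic; try (intros x; derive; field).
  - cont; lra.
  - cont; lra.
Qed.

Lemma helmholtz_C0T (f v v' : R -> R) : helmholtz f v v' -> C0T f.
Proof.
  intros [Hv Hv']; split.
  - intros x; assert (Hper := proj1 (C1T_derivative _ _ Hv') x).
    cbv beta in Hper; rewrite (proj1 Hv) in Hper; lra.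
  - intros x; apply (continuity_pt_ext (fun y => v y - (v y - f y))); [intros; ring|].
    apply continuity_pt_minus; [cont | apply (proj2 (proj2 Hv'))].
Qed.

Lemma helmholtz_minus (f g v v' w w' : R -> R) : helmholtz f v v' -> helmholtz g w w' ->
  helmholtz (fun x => f x - g x) (fun x => v x - w x) (fun x => v' x - w' x).
Proof.
  intros Hv Hw; assert (Hf := helmholtz_C0T _ _ _ Hv); assert (Hg := helmholtz_C0T _ _ _ Hw).
  destruct Hv as [Hv Hv'], Hw as [Hw Hw']; split; [apply C1T_minus; assumption|].
  split; [periodic | split; [intros x; derive; ring | cont]].
Qed.

Lemma helmholtz_bound (f v v' : R -> R) (x : R) : helmholtz f v v' ->
  Rabs (v x) <= 3 * mean (fun y => Rabs (f y)) /\
  Rabs (v' x) <= 3 * mean (fun y => Rabs (f y)).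
Proof.
  intros Hv; assert (Hf := helmholtz_C0T _ _ _ Hv); destruct Hv as [Hv Hv'].
  assert (Hplus : Rabs (v x + v' x) <= 3 * mean (fun y => Rabs (f y))).
  { apply (unit_resolvent_equation_bound 1 (fun y => v y + v' y) f); try assumption.
    - left; reflexivity.
    - periodic.
    - intros y; derive; ring. }
  assert (Hminus : Rabs (v x - v' x) <= 3 * mean (fun y => Rabs (f y))).
  { apply (unit_resolvent_equation_bound (-1) (fun y => v y - v' y) f); try assumption.
    - right; reflexivity.
    - periodic.
    - intros y; derive; ring. }
  apply Rabs_le_between in Hplus, Hminus; split; apply Rabs_le_between; lra.
Qed.

Lemma helmholtz_sup_bound (f v v' : R -> R) (K x : R) : helmholtz f v v' ->
  (forall y, Rabs (f y) <= K) -> Rabs (v x) <= 3 * K /\ Rabs (v' x) <= 3 * K.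
Proof.
  intros Hv HK; assert (Hf := helmholtz_C0T _ _ _ Hv).
  assert (Hmean : mean (fun y => Rabs (f y)) <= K) by (apply mean_le_const; [cont | exact HK]).
  assert (Hbound := helmholtz_bound f v v' x Hv); lra.
Qed.

Lemma helmholtz_sq_bound (f v v' : R -> R) (x : R) : helmholtz f v v' ->
  v x ^ 2 <= 9 * mean (fun y => f y ^ 2) /\ v' x ^ 2 <= 9 * mean (fun y => f y ^ 2).
Proof.
  intros Hv; assert (Hsq := mean_abs_sq f (proj2 (helmholtz_C0T _ _ _ Hv))).
  destruct (helmholtz_bound f v v' x Hv) as [Hbound Hbound'].
  apply (pow_maj_Rabs _ _ 2) in Hbound, Hbound'; lra.
Qed.

Lemma helmholtz_unique (f v v' w w' : R -> R) : helmholtz f v v' -> helmholtz f w w' ->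
  forall x, v x = w x /\ v' x = w' x.
Proof.
  intros Hv Hw x.
  destruct (helmholtz_sup_bound _ _ _ 0 x (helmholtz_minus _ _ _ _ _ _ Hv Hw)) as [Hval Hder].
  - intros y; rewrite Rminus_diag, Rabs_R0; lra.
  - apply Rabs_le_between in Hval, Hder; lra.
Qed.

Lemma helmholtz_weak (f v v' w w' : R -> R) : helmholtz f v v' -> C1T w w' ->
  mean (fun x => v x * w x + v' x * w' x - f x * w x) = 0.
Proof.
  intros [_ Hv'] Hw; rewrite <- (mean_parts v' _ w w' Hv' Hw).
  apply mean_ext; intros x; ring.
Qed.

(** * Implicit differentiation and geometric convergence *)

Lemma caratheodory (f : R -> R) (x l : R) :
  derivable_pt_lim f x l <->
  exists slope, continuity_pt slope x /\ slope x = l /\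
    forall y, f y - f x = slope y * (y - x).
Proof.
  split.
  - intros Hf; exists (fun y => if Req_EM_T y x then l else (f y - f x) / (y - x)).
    assert (Hx : (if Req_EM_T x x then l else (f x - f x) / (x - x)) = l)
      by (destruct (Req_EM_T x x); [reflexivity | lra]).
    split; [|split; [exact Hx|]].
    + intros e He; destruct (Hf e He) as [d Hd].
      exists d; split; [apply cond_pos|]; simpl; unfold R_dist; intros y [_ Hy]; rewrite Hx.
      destruct (Req_EM_T y x) as [Hyx|Hyx]; [rewrite Rminus_diag, Rabs_R0; exact He|].
      specialize (Hd (y - x) ltac:(lra) Hy).
      replace (x + (y - x)) with y in Hd by ring; exact Hd.
    + intros y; destruct (Req_EM_T y x) as [->|Hyx]; [ring | field; lra].
  - intros [slope [Hcont [Hx Hslope]]] e He; destruct (Hcont e He) as [d [Hd Hclose]].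
    exists (mkposreal d Hd); intros h Hh0 Hh; simpl in Hh.
    replace ((f (x + h) - f x) / h) with (slope (x + h))
      by (rewrite Hslope; field; exact Hh0).
    rewrite <- Hx; apply (Hclose (x + h)); split; [split; [exact I | lra]|].
    simpl; unfold R_dist; replace (x + h - x) with h by ring; exact Hh.
Qed.

Lemma implicit_derivative (g p n Y : R -> R) (a x l n' Y' : R) : 0 < a ->
  (forall s t, 0 <= (g s - g t) * (s - t)) -> (forall y, 0 <= n y) ->
  (forall y, a * p y + n y * g (p y) = Y y) -> continuity_pt p x ->
  derivable_pt_lim g (p x) l -> derivable_pt_lim n x n' -> derivable_pt_lim Y x Y' ->
  derivable_pt_lim p x ((Y' - n' * g (p x)) / (a + n x * l)).
Proof.
  intros Ha Hmono Hn HY Hp Hg' Hn' HY'.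
  assert (Cn := derivable_pt_lim_continuity_pt n x n' Hn').
  assert (Hl := monotone_derivative_nonneg g (p x) l Hmono Hg').
  apply caratheodory in Hg' as [sg [Csg [<- Hsg]]], Hn' as [sn [Csn [<- Hsn]]],
    HY' as [sY [CsY [<- HsY]]].
  assert (Hsg0 : forall t, 0 <= sg t).
  { intros t; destruct (Req_dec t (p x)) as [->|Ht]; [exact Hl|].
    specialize (Hmono t (p x)); rewrite Hsg in Hmono.
    apply (Rmult_le_reg_r ((t - p x) ^ 2)); [apply pow2_gt_0 |]; lra. }
  assert (Hden : forall y, 0 < a + n y * sg (p y)).
  { intros y; assert (0 <= n y * sg (p y)) by (apply Rmult_le_pos; auto); lra. }
  apply caratheodory; exists (fun y => (sY y - sn y * g (p x)) / (a + n y * sg (p y))).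
  split; [|split; [reflexivity|]].
  - cont; apply Rgt_not_eq, Hden.
  - intros y; specialize (Hden y); apply (Rmult_eq_reg_r (a + n y * sg (p y))); [|lra].
    transitivity (sY y * (y - x) - g (p x) * (sn y * (y - x))); [|field; lra].
    rewrite <- HsY, <- Hsn, <- !HY.
    transitivity (a * (p y - p x) + n y * (sg (p y) * (p y - p x))); [ring|].
    rewrite <- Hsg; ring.
Qed.

Lemma is_lim_seq_scal_geom (C q : R) : 0 <= q < 1 -> is_lim_seq (fun n => C * q ^ n) 0.
Proof.
  intros Hq; rewrite <- (Rmult_0_r C).
  apply (is_lim_seq_scal_l _ C 0), is_lim_seq_geom; rewrite Rabs_pos_eq; lra.
Qed.

Lemma geometric_limit (u : nat -> R) (C q : R) : 0 <= q < 1 ->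
  (forall n, Rabs (u (S n) - u n) <= C * (1 - q) * q ^ n) ->
  forall n, Rabs (u n - Lim_seq u) <= C * q ^ n.
Proof.
  intros Hq Hu.
  assert (Hgeom := is_lim_seq_scal_geom C q Hq).
  set (lower := fun n => u n - C * q ^ n); set (upper := fun n => u n + C * q ^ n).
  assert (Hstep : forall n, lower n <= lower (S n) /\ upper (S n) <= upper n).
  { intros n; specialize (Hu n); apply Rabs_le_between in Hu.
    unfold lower, upper; simpl pow; lra. }
  destruct (ex_lim_seq_adj lower upper) as [[l Hl] _];
    [intros n; apply Hstep | intros n; apply Hstep | |].
  { apply (is_lim_seq_ext (fun n => C * q ^ n + C * q ^ n)).
    - intros n; unfold lower, upper; ring.
    - rewrite <- (Rplus_0_r 0); apply is_lim_seq_plus'; exact Hgeom. }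
  assert (Hlim : is_lim_seq u l).
  { apply (is_lim_seq_ext (fun n => lower n + C * q ^ n)); [intros; unfold lower; ring|].
    rewrite <- (Rplus_0_r l); apply is_lim_seq_plus'; assumption. }
  assert (Hupper : is_lim_seq upper l).
  { rewrite <- (Rplus_0_r l); apply is_lim_seq_plus'; assumption. }
  intros n; rewrite (is_lim_seq_unique _ _ Hlim).
  assert (Hle := is_lim_seq_incr_compare _ _ Hl (fun n => proj1 (Hstep n)) n).
  assert (Hge := is_lim_seq_decr_compare _ _ Hupper (fun n => proj2 (Hstep n)) n).
  unfold lower, upper in Hle, Hge; simpl; apply Rabs_le_between; lra.
Qed.

Lemma geometric_eventually_small (C q e : R) : 0 <= q < 1 -> 0 < e ->
  exists N, forall n, (N <= n)%nat -> C * q ^ n < e.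
Proof.
  intros Hq He; assert (Hgeom := is_lim_seq_scal_geom C q Hq).
  apply is_lim_seq_spec in Hgeom; destruct (Hgeom (mkposreal e He)) as [N HN].
  exists N; intros n Hn; specialize (HN n Hn); simpl in HN; apply Rabs_lt_between in HN; lra.
Qed.

Lemma geometric_CVU (f : nat -> R -> R) (g : R -> R) (C q x : R) (r : posreal) : 0 <= q < 1 ->
  (forall n y, Rabs (f n y - g y) <= C * q ^ n) -> CVU f g x r.
Proof.
  intros Hq Hf e He; destruct (geometric_eventually_small C q e Hq He) as [N HN].
  exists N; intros n y Hn _; specialize (HN n Hn); specialize (Hf n y).
  rewrite Rabs_minus_sym; lra.
Qed.

Lemma geometric_zero (a C q : R) : 0 <= q < 1 -> (forall n, Rabs a <= C * q ^ n) -> a = 0.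
Proof.
  intros Hq Ha; destruct (Req_dec a 0) as [|Hne]; [assumption|exfalso].
  destruct (geometric_eventually_small C q (Rabs a) Hq) as [N HN]; [apply Rabs_pos_lt, Hne|].
  specialize (HN N (le_n N)); specialize (Ha N); lra.
Qed.

Lemma C1T_geometric_limit (f f' : nat -> R -> R) (g g' : R -> R) (C q : R) : 0 <= q < 1 ->
  (forall n, C1T (f n) (f' n)) -> (forall n x, Rabs (f n x - g x) <= C * q ^ n) ->
  (forall n x, Rabs (f' n x - g' x) <= C * q ^ n) -> C1T g g'.
Proof.
  intros Hq Hf Hg Hg'; assert (Hball : forall x, Boule x (mkposreal 1 Rlt_0_1) x).
  { intros x; unfold Boule; simpl; rewrite Rminus_diag, Rabs_R0; lra. }
  split; [|split].
  - intros x; apply Rminus_diag_uniq, (geometric_zero _ (2 * C) q Hq); intros n.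
    assert (Hx := Hg n x); assert (Hx1 := Hg n (x + 1)); rewrite (proj1 (Hf n)) in Hx1.
    apply Rabs_le_between in Hx, Hx1; apply Rabs_le_between; lra.
  - intros x; apply (CVU_derivable f f' g g' x (mkposreal 1 Rlt_0_1)).
    + apply (geometric_CVU f' g' C q); assumption.
    + intros y Hy e He; destruct (geometric_CVU f g C q x (mkposreal 1 Rlt_0_1) Hq Hg e He)
        as [N HN].
      exists N; intros n Hn; unfold R_dist; rewrite Rabs_minus_sym; apply HN; assumption.
    + intros n y _; apply Hf.
    + apply Hball.
  - intros x; apply (CVU_continuity f' g' x (mkposreal 1 Rlt_0_1)).
    + apply (geometric_CVU f' g' C q); assumption.
    + intros n y _; apply Hf.
    + apply Hball.
Qed.

(** * States and local fixed points *)

(* [Ux] and [Mx] stand for the first derivatives of the unknowns [u] and [m]. *)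
Inductive unknown : Set := U | M | Ux | Mx.

Definition state : Type := unknown -> R -> R.

Definition regular (z : state) : Prop := C1T (z U) (z Ux) /\ C1T (z M) (z Mx).

Definition difference (z1 z2 : state) : state := fun i x => z1 i x - z2 i x.

Definition close (d : R) (z1 z2 : state) : Prop :=
  forall i x, Rabs (z1 i x - z2 i x) <= d.

Lemma regular_C0T (z : state) (i : unknown) : regular z -> C0T (z i).
Proof. intros [Hu Hm]; destruct i; eauto using C1T_C0T, C1T_derivative. Qed.

Lemma regular_difference (z1 z2 : state) :
  regular z1 -> regular z2 -> regular (difference z1 z2).
Proof. intros [] []; split; apply C1T_minus; assumption. Qed.

Lemma close_sym (d : R) (z1 z2 : state) : close d z1 z2 -> close d z2 z1.
Proof. intros Hz i x; rewrite Rabs_minus_sym; apply Hz. Qed.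

Lemma close_trans (d d' : R) (z1 z2 z3 : state) :
  close d z1 z2 -> close d' z2 z3 -> close (d + d') z1 z3.
Proof.
  intros Hleft Hright i x; specialize (Hleft i x); specialize (Hright i x).
  apply Rabs_le_between in Hleft, Hright; apply Rabs_le_between; lra.
Qed.

Lemma close_weaken (d d' : R) (z1 z2 : state) : d <= d' -> close d z1 z2 -> close d' z1 z2.
Proof. intros Hd Hz i x; apply Rle_trans with d; [apply Hz | exact Hd]. Qed.

Lemma pow_unit_interval (q : R) (n : nat) : 0 <= q <= 1 -> 0 <= q ^ n <= 1.
Proof.
  intros Hq; split; [apply pow_le; lra|]; rewrite <- (pow1 n); apply pow_incr; lra.
Qed.

Section LocalFixedPoint.

(* The contraction is measured by [near], which need only dominate the uniform distance. *)
Variables (T : state -> state) (near : R -> state -> Prop) (c q K : R) (z0 : state).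
Hypothesis Hc : 0 <= c.
Hypothesis Hq : 0 <= q < 1.
Hypothesis Hz0 : regular z0.
Hypothesis near_uniform : forall d b, regular d -> near b d -> forall i x, Rabs (d i x) <= b.
Hypothesis T_regular : forall z, regular z -> close c z z0 -> regular (T z).
Hypothesis T_contracts : forall z1 z2 b, regular z1 -> regular z2 ->
  close c z1 z0 -> close c z2 z0 ->
  near b (difference z1 z2) -> near (q * b) (difference (T z1) (T z2)).
Hypothesis T_lipschitz : forall z1 z2 d, regular z1 -> regular z2 ->
  close c z1 z0 -> close c z2 z0 -> close d z1 z2 -> close (K * d) (T z1) (T z2).
Hypothesis T_start : near (c * (1 - q)) (difference (T z0) z0).

Let iterate (n : nat) : state := Nat.iter n T z0.

Lemma iterate_invariant (n : nat) :
  regular (iterate n) /\ close (c * (1 - q ^ n)) (iterate n) z0 /\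
  near (c * (1 - q) * q ^ n) (difference (iterate (S n)) (iterate n)).
Proof.
  assert (Hball : forall j, close (c * (1 - q ^ j)) (iterate j) z0 -> close c (iterate j) z0).
  { intros j; apply close_weaken; assert (Hj := pow_unit_interval q j ltac:(lra)); nra. }
  induction n as [|n [Hreg [Hclose Hnear]]].
  - split; [exact Hz0 | split].
    + intros i x; simpl; rewrite !Rminus_diag, Rabs_R0; lra.
    + simpl pow; rewrite Rmult_1_r; exact T_start.
  - assert (Hreg' : regular (iterate (S n))) by (apply T_regular; auto).
    assert (Hclose' : close (c * (1 - q ^ S n)) (iterate (S n)) z0).
    { replace (c * (1 - q ^ S n)) with (c * (1 - q) * q ^ n + c * (1 - q ^ n))
        by (simpl; ring).
      apply close_trans with (iterate n); [|exact Hclose].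
      intros i x; apply (near_uniform (difference (iterate (S n)) (iterate n)));
        [apply regular_difference; assumption | exact Hnear]. }
    split; [exact Hreg' | split; [exact Hclose'|]].
    replace (c * (1 - q) * q ^ S n) with (q * (c * (1 - q) * q ^ n)) by (simpl; ring).
    apply (T_contracts (iterate (S n)) (iterate n)); auto.
Qed.

Lemma local_fixed_point : exists z, regular z /\ close c z z0 /\ forall i x, T z i x = z i x.
Proof.
  set (z := fun i x => real (Lim_seq (fun n => iterate n i x))).
  assert (Hreg : forall n, regular (iterate n)) by (intros n; apply iterate_invariant).
  assert (Hball : forall n, close c (iterate n) z0).
  { intros n; eapply close_weaken; [|apply iterate_invariant].
    assert (Hn := pow_unit_interval q n ltac:(lra)); nra. }
  assert (Hlim : forall n, close (c * q ^ n) (iterate n) z).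
  { intros n i x; apply (geometric_limit (fun n => iterate n i x)); [exact Hq|].
    intros j; apply (near_uniform (difference (iterate (S j)) (iterate j)));
      [apply regular_difference; apply Hreg | apply iterate_invariant]. }
  assert (Hz : regular z).
  { split;
      [apply (C1T_geometric_limit (fun n => iterate n U) (fun n => iterate n Ux) _ _ c q)
      |apply (C1T_geometric_limit (fun n => iterate n M) (fun n => iterate n Mx) _ _ c q)];
      try exact Hq; intros n; try intros x; first [apply Hreg | apply Hlim]. }
  assert (Hz_ball : close c z z0).
  { apply close_sym; replace c with (c * q ^ 0) by (simpl; ring); apply (Hlim 0%nat). }
  exists z; split; [exact Hz | split; [exact Hz_ball|]]; intros i x.
  apply Rminus_diag_uniq, (geometric_zero _ (K * c + c * q) q Hq); intros n.
  assert (HTz : close (K * (c * q ^ n)) (T z) (iterate (S n))).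
  { apply close_sym, T_lipschitz; auto. }
  replace ((K * c + c * q) * q ^ n) with (K * (c * q ^ n) + c * q ^ S n) by (simpl; ring).
  exact (close_trans _ _ _ _ _ HTz (Hlim (S n)) i x).
Qed.

End LocalFixedPoint.

(** * One relaxation step is a contraction *)

Definition energy (d : state) (x : R) : R := d U x ^ 2 + d M x ^ 2 + d Ux x ^ 2 + d Mx x ^ 2.

(* The [H^1 x H^1] norm of [d] is at most [k * b] and the derivatives are at most [b]: a
   relaxation step contracts the former by itself, and the latter up to the former. *)
Definition near (k b : R) (d : state) : Prop :=
  0 <= b /\ mean (energy d) <= (k * b) ^ 2 /\ forall x, d Ux x ^ 2 + d Mx x ^ 2 <= b ^ 2.

Lemma energy_nonneg (d : state) (x : R) : 0 <= energy d x.
Proof. unfold energy; nra. Qed.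

Lemma energy_continuity (d : state) : (forall i, continuity (d i)) -> continuity (energy d).
Proof. intros Hd; unfold energy; cont. Qed.

Lemma Rabs_le_of_sq_le (a b : R) : 0 <= b -> a ^ 2 <= b ^ 2 -> Rabs a <= b.
Proof.
  intros Hb Hab; rewrite <- (Rabs_pos_eq b Hb); apply Rsqr_le_abs_0; unfold Rsqr; lra.
Qed.

Lemma regular_sobolev (d : state) (x : R) : regular d ->
  d U x ^ 2 <= 9 * mean (energy d) /\ d M x ^ 2 <= 9 * mean (energy d).
Proof.
  intros [Hu Hm]; split; (eapply Rle_trans; [apply sobolev; eassumption|]);
    (apply Rmult_le_compat_l; [lra|]; apply mean_le; [cont | unfold energy; cont |]);
    intros y; unfold energy; nra.
Qed.

Lemma near_uniform_bound (k : R) (d : state) (b : R) : 9 * k ^ 2 <= 1 -> regular d ->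
  near k b d -> forall i x, Rabs (d i x) <= b.
Proof.
  intros Hk Hd [Hb [Henergy Hsup]] i x; apply Rabs_le_of_sq_le; [exact Hb|].
  destruct (regular_sobolev d x Hd) as [Hu Hm]; specialize (Hsup x).
  assert (Hkb : 9 * (k * b) ^ 2 <= b ^ 2).
  { rewrite Rpow_mult_distr; nra. }
  destruct i; nra.
Qed.

Lemma uniform_bound_near (k b e : R) (d : state) : 0 < k <= 1 -> 2 * e <= k * b ->
  (forall i, continuity (d i)) -> (forall i x, Rabs (d i x) <= e) -> near k b d.
Proof.
  intros Hk Heb Hcont Hd.
  assert (He : 0 <= e) by (eapply Rle_trans; [apply Rabs_pos | apply (Hd U 0)]).
  assert (Hsq : forall i x, d i x ^ 2 <= e ^ 2) by (intros i x; apply pow_maj_Rabs, Hd).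
  assert (Hb : 2 * e <= b) by nra.
  split; [lra | split].
  - apply Rle_trans with ((2 * e) ^ 2); [|apply pow_incr; lra].
    apply mean_le_const; [apply energy_continuity, Hcont | intros x; unfold energy].
    assert (HsqU := Hsq U x); assert (HsqM := Hsq M x); assert (HsqUx := Hsq Ux x);
      assert (HsqMx := Hsq Mx x); lra.
  - intros x; assert (HsqUx := Hsq Ux x); assert (HsqMx := Hsq Mx x); nra.
Qed.

(* For [helmholtz F v v'] and [helmholtz P w w'], the defect of the system
   [v = u - eps m], [w = m_x + eps u_x + P] together with its derivative. *)
Definition residual (eps : R) (z : state) (v v' w w' P : R -> R) : state :=
  fun i x => match i with
  | U => z M x + eps * z U x - w' x
  | M => v x - (z U x - eps * z M x)
  | Ux => z Mx x + eps * z Ux x - (w x - P x)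
  | Mx => v' x - (z Ux x - eps * z Mx x)
  end.

Definition relax (tau : R) (z r : state) : state := fun i x => z i x - tau * r i x.

Lemma residual_difference (eps : R) (z1 z2 : state)
    (v1 v1' w1 w1' P1 v2 v2' w2 w2' P2 : R -> R) :
  difference (residual eps z1 v1 v1' w1 w1' P1) (residual eps z2 v2 v2' w2 w2' P2)
  = residual eps (difference z1 z2) (fun x => v1 x - v2 x) (fun x => v1' x - v2' x)
      (fun x => w1 x - w2 x) (fun x => w1' x - w2' x) (fun x => P1 x - P2 x).
Proof.
  extensionality i; extensionality x; destruct i; unfold residual, difference; ring.
Qed.

Lemma relax_difference (tau : R) (z1 r1 z2 r2 : state) :
  difference (relax tau z1 r1) (relax tau z2 r2)
  = relax tau (difference z1 z2) (difference r1 r2).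
Proof. extensionality i; extensionality x; unfold relax, difference; ring. Qed.

(* What is known of the differences [F], [P] of the sources of two states whose difference
   is [d]: Lipschitz bounds, and monotonicity both jointly and in the derivative alone. *)
Definition source_control (L : R) (d : state) (F P : R -> R) : Prop := forall x,
  Rabs (F x) <= L * (Rabs (d M x) + Rabs (d Ux x)) /\
  0 <= F x * d M x + P x * d Ux x /\
  exists k c, P x = k + c * d M x /\
    0 <= k * d Ux x /\ Rabs k <= L * Rabs (d Ux x) /\ Rabs c <= L.

Lemma source_control_flux (L : R) (d : state) (F P : R -> R) (x : R) : source_control L d F P ->
  Rabs (P x) <= L * (Rabs (d M x) + Rabs (d Ux x)).
Proof.
  intros Hsrc; destruct (Hsrc x) as [_ [_ [k [c [-> [_ [Hk Hc]]]]]]].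
  eapply Rle_trans; [apply Rabs_triang|]; rewrite Rabs_mult.
  apply (Rmult_le_compat_r (Rabs (d M x))) in Hc; [lra | apply Rabs_pos].
Qed.

Lemma sq_le_of_abs_le (L a b t : R) : Rabs t <= L * (Rabs a + Rabs b) ->
  t ^ 2 <= 2 * L ^ 2 * (a ^ 2 + b ^ 2).
Proof.
  intros Ht; apply (pow_maj_Rabs _ _ 2) in Ht.
  rewrite <- (pow2_abs a), <- (pow2_abs b).
  assert (Hsq := pow2_ge_0 (Rabs a - Rabs b)).
  rewrite Rpow_mult_distr in Ht; nra.
Qed.

Lemma source_control_sq (L : R) (d : state) (F P : R -> R) (x : R) : source_control L d F P ->
  F x ^ 2 <= 2 * L ^ 2 * energy d x /\ P x ^ 2 <= 2 * L ^ 2 * energy d x.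
Proof.
  intros Hsrc; destruct (Hsrc x) as [HF _].
  assert (HPabs := source_control_flux L d F P x Hsrc).
  apply sq_le_of_abs_le in HF, HPabs.
  assert (Hle : 2 * L ^ 2 * (d M x ^ 2 + d Ux x ^ 2) <= 2 * L ^ 2 * energy d x).
  { apply Rmult_le_compat_l; [|unfold energy]; nra. }
  lra.
Qed.

(* Up to a perturbation [k] that is monotone in [p], a relaxation step acts on the derivatives
   [(p, r)] as a rotation by a right angle plus [eps] times the identity. *)
Lemma planar_contraction (eps tau L p r k : R) : 0 < eps <= 1 -> 0 < tau ->
  tau * (4 + 2 * L ^ 2) <= eps -> 0 <= k * p -> Rabs k <= L * Rabs p ->
  (p - tau * (r + eps * p + k)) ^ 2 + (r - tau * (eps * r - p)) ^ 2
  <= (1 - tau * eps) * (p ^ 2 + r ^ 2).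
Proof.
  intros Heps Htau HtauL Hkp Hk; apply (pow_maj_Rabs _ _ 2) in Hk.
  rewrite Rpow_mult_distr, pow2_abs in Hk.
  assert (Hpos : 0 <= p ^ 2 + r ^ 2) by nra.
  assert (Hrot : (r + eps * p) ^ 2 + (eps * r - p) ^ 2 <= 2 * (p ^ 2 + r ^ 2)).
  { replace (_ + _) with ((1 + eps ^ 2) * (p ^ 2 + r ^ 2)) by ring.
    apply Rmult_le_compat_r; nra. }
  assert (Hsize : (r + eps * p + k) ^ 2 + (eps * r - p) ^ 2 <= (4 + 2 * L ^ 2) * (p ^ 2 + r ^ 2)).
  { assert (Hsq := pow2_ge_0 (r + eps * p - k)); assert (Hsq' := pow2_ge_0 (eps * r - p)).
    assert (0 <= L ^ 2 * r ^ 2) by (apply Rmult_le_pos; apply pow2_ge_0); lra. }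
  apply (Rmult_le_compat_l (tau ^ 2)) in Hsize; [|apply pow2_ge_0].
  apply (Rmult_le_compat_r (p ^ 2 + r ^ 2)) in HtauL; [|exact Hpos].
  apply (Rmult_le_compat_l tau) in HtauL; [|lra].
  assert (0 <= tau * (k * p)) by (apply Rmult_le_pos; lra); lra.
Qed.

Lemma young (s t y z : R) : 0 < s ->
  (y + t * z) ^ 2 <= (1 + s) * y ^ 2 + (1 + / s) * t ^ 2 * z ^ 2.
Proof.
  intros Hs.
  assert (Hgap : (1 + s) * y ^ 2 + (1 + / s) * t ^ 2 * z ^ 2 - (y + t * z) ^ 2
                 = / s * (s * y - t * z) ^ 2) by (field; lra).
  assert (0 <= / s * (s * y - t * z) ^ 2); [|lra].
  apply Rmult_le_pos; [left; apply Rinv_0_lt_compat, Hs | apply pow2_ge_0].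
Qed.

Section Contraction.

Variables (eps tau L : R) (d : state) (F P v v' w w' : R -> R).
Hypothesis Heps : 0 < eps <= 1.
Hypothesis Htau : 0 < tau.
Hypothesis HtauL : tau * (4 + 188 * L ^ 2) <= eps.
Hypothesis Hd : regular d.
Hypothesis Hv : helmholtz F v v'.
Hypothesis Hw : helmholtz P w w'.
Hypothesis Hsrc : source_control L d F P.

Let r : state := residual eps d v v' w w' P.

Lemma residual_continuity (i : unknown) : continuity (r i).
Proof.
  destruct Hd, Hv, Hw.
  destruct i; unfold r, residual; cont.
Qed.

Lemma energy_d_continuity : continuity (energy d).
Proof. apply energy_continuity; intros i; apply (regular_C0T d i Hd). Qed.

Lemma helmholtz_source_sq (f g g' : R -> R) (x : R) : helmholtz f g g' ->
  (forall y, f y ^ 2 <= 2 * L ^ 2 * energy d y) ->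
  g x ^ 2 <= 18 * L ^ 2 * mean (energy d) /\ g' x ^ 2 <= 18 * L ^ 2 * mean (energy d).
Proof.
  intros Hg Hf; assert (Hfc := helmholtz_C0T _ _ _ Hg); assert (Hc := energy_d_continuity).
  assert (Hmean : mean (fun y => f y ^ 2) <= 2 * L ^ 2 * mean (energy d)).
  { rewrite <- mean_mult_l by exact Hc; apply mean_le; [cont | cont | exact Hf]. }
  assert (Hsq := helmholtz_sq_bound f g g' x Hg); lra.
Qed.

Lemma source_potentials_sq (x : R) :
  (v x ^ 2 <= 18 * L ^ 2 * mean (energy d) /\ v' x ^ 2 <= 18 * L ^ 2 * mean (energy d)) /\
  (w x ^ 2 <= 18 * L ^ 2 * mean (energy d) /\ w' x ^ 2 <= 18 * L ^ 2 * mean (energy d)).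
Proof.
  split; [apply (helmholtz_source_sq F) | apply (helmholtz_source_sq P)]; try assumption;
    intros y; apply (source_control_sq L d F P y Hsrc).
Qed.

Lemma residual_energy : mean (energy r) <= (4 + 188 * L ^ 2) * mean (energy d).
Proof.
  assert (Hc := energy_d_continuity).
  apply Rle_trans with
    (mean (fun x => (4 + 8 * L ^ 2) * energy d x + 180 * L ^ 2 * mean (energy d))).
  2:{ rewrite mean_plus, mean_mult_l, mean_const by cont; lra. }
  apply mean_le; [apply energy_continuity, residual_continuity | cont | intros x].
  destruct (source_potentials_sq x) as [[Bv Bv'] [Bw Bw']].
  destruct (source_control_sq L d F P x Hsrc) as [_ BP].
  assert (Hsum : forall a b, (a + b) ^ 2 <= 2 * a ^ 2 + 2 * b ^ 2)
    by (intros a b; assert (Hsq := pow2_ge_0 (a - b)); lra).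
  assert (BU := Hsum (d M x + eps * d U x) (- w' x)).
  assert (BM := Hsum (- (d U x - eps * d M x)) (v x)).
  assert (BUx := Hsum (d Mx x + eps * d Ux x) (P x - w x)).
  assert (BMx := Hsum (- (d Ux x - eps * d Mx x)) (v' x)).
  assert (BPw := Hsum (P x) (- w x)).
  assert (Hrot : (d M x + eps * d U x) ^ 2 + (- (d U x - eps * d M x)) ^ 2
    + ((d Mx x + eps * d Ux x) ^ 2 + (- (d Ux x - eps * d Mx x)) ^ 2) <= 2 * energy d x).
  { replace (_ + _) with ((1 + eps ^ 2) * energy d x) by (unfold energy; ring).
    apply Rmult_le_compat_r; [apply energy_nonneg | nra]. }
  unfold energy at 1, r, residual; lra.
Qed.

Lemma residual_coercive :
  eps * mean (energy d)
  <= mean (fun x => d U x * r U x + d M x * r M x + d Ux x * r Ux x + d Mx x * r Mx x).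
Proof.
  assert (Hc := energy_d_continuity).
  assert (HF := helmholtz_C0T _ _ _ Hv).
  assert (WF := helmholtz_weak F v v' _ _ Hv (proj2 Hd)).
  assert (WP := mean_parts w w' _ _ (proj1 Hw) (proj1 Hd)).
  assert (Rc := residual_continuity).
  destruct Hd as [Hdu Hdm], Hv as [Cv Cv'], Hw as [Cw Cw'].
  rewrite <- mean_mult_l, <- (Rplus_0_r (mean _)), <- WF by exact Hc.
  rewrite <- (Rplus_0_r (mean (fun x => v x * _ + _ - _))).
  replace 0 with (-1 * mean (fun x => w' x * d U x + w x * d Ux x)) by (rewrite WP; ring).
  rewrite <- mean_mult_l, <- !mean_plus by cont.
  apply mean_le; [cont | cont | intros x].
  destruct (Hsrc x) as [_ [Hmono _]]; unfold r, residual, energy; lra.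
Qed.

Lemma relax_energy : mean (energy (relax tau d r)) <= (1 - tau * eps) * mean (energy d).
Proof.
  assert (Hc := energy_d_continuity); assert (Rc := residual_continuity).
  assert (Ec := energy_continuity r Rc); destruct Hd as [Hdu Hdm].
  set (dot := fun x => d U x * r U x + d M x * r M x + d Ux x * r Ux x + d Mx x * r Mx x).
  assert (Hdot : continuity dot) by (unfold dot; cont).
  rewrite (mean_ext _ (fun x => energy d x + (- (2 * tau) * dot x + tau ^ 2 * energy r x)))
    by (intros x; unfold energy, relax, dot; ring).
  rewrite !mean_plus, !mean_mult_l by cont.
  assert (Hcoercive := residual_coercive); fold dot in Hcoercive.
  assert (Hsize := residual_energy).
  assert (HE : 0 <= mean (energy d)) by (apply mean_nonneg; [cont | apply energy_nonneg]).
  apply (Rmult_le_compat_l tau) in Hcoercive; [|lra].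
  apply (Rmult_le_compat_l (tau ^ 2)) in Hsize; [|apply pow2_ge_0].
  apply (Rmult_le_compat_r (mean (energy d))) in HtauL; [|exact HE].
  apply (Rmult_le_compat_l tau) in HtauL; [|lra]; lra.
Qed.

Let s : R := tau * eps / 2.

Lemma relax_derivatives (x : R) :
  relax tau d r Ux x ^ 2 + relax tau d r Mx x ^ 2
  <= (1 - s) * (d Ux x ^ 2 + d Mx x ^ 2)
     + (1 + / s) * tau ^ 2 * (72 * L ^ 2) * mean (energy d).
Proof.
  assert (Hs : 0 < s) by (unfold s; assert (0 < tau * eps) by (apply Rmult_lt_0_compat; lra); lra).
  destruct (source_potentials_sq x) as [[_ Bv'] [Bw _]].
  destruct (Hsrc x) as [_ [_ [k [c [HP [Hkp [Hk Hc]]]]]]].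
  set (a := d Ux x - tau * (d Mx x + eps * d Ux x + k)).
  set (b := d Mx x - tau * (eps * d Mx x - d Ux x)).
  set (g := w x - c * d M x).
  assert (Hg : g ^ 2 <= 54 * L ^ 2 * mean (energy d)).
  { assert (Hcm : (c * d M x) ^ 2 <= L ^ 2 * (9 * mean (energy d))).
    { rewrite Rpow_mult_distr; apply Rmult_le_compat; try apply pow2_ge_0;
        [apply pow_maj_Rabs, Hc | apply (regular_sobolev d x Hd)]. }
    assert (Hsq := pow2_ge_0 (w x + c * d M x)); unfold g; lra. }
  assert (Hab : a ^ 2 + b ^ 2 <= (1 - tau * eps) * (d Ux x ^ 2 + d Mx x ^ 2)).
  { apply (planar_contraction eps tau L); try assumption.
    assert (HL := pow2_ge_0 L); assert (0 <= tau * L ^ 2) by (apply Rmult_le_pos; lra); lra. }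
  replace (relax tau d r Ux x) with (a + tau * g)
    by (unfold relax, r, residual, a, g; rewrite HP; ring).
  replace (relax tau d r Mx x) with (b + tau * - v' x) by (unfold relax, r, residual, b; ring).
  assert (Ya := young s tau a g Hs); assert (Yb := young s tau b (- v' x) Hs).
  assert (HK : 0 <= (1 + / s) * tau ^ 2).
  { apply Rmult_le_pos; [|apply pow2_ge_0].
    assert (0 < / s) by (apply Rinv_0_lt_compat, Hs); lra. }
  assert (Hpert : (1 + / s) * tau ^ 2 * (g ^ 2 + (- v' x) ^ 2)
                  <= (1 + / s) * tau ^ 2 * (72 * L ^ 2 * mean (energy d)))
    by (apply Rmult_le_compat_l; [exact HK | lra]).
  apply (Rmult_le_compat_l (1 + s)) in Hab; [|lra].
  replace (tau * eps) with (2 * s) in Hab by (unfold s; field).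
  assert (0 <= s ^ 2 * (d Ux x ^ 2 + d Mx x ^ 2)); [|lra].
  apply Rmult_le_pos; nra.
Qed.

End Contraction.

Lemma relax_contraction (eps L : R) : 0 < eps <= 1 ->
  exists tau k q, 0 < tau <= 1 /\ 0 < k /\ 9 * k ^ 2 <= 1 /\ 0 <= q < 1 /\
    forall b d F P v v' w w', regular d -> helmholtz F v v' -> helmholtz P w w' ->
      source_control L d F P -> near k b d ->
      near k (q * b) (relax tau d (residual eps d v v' w w' P)).
Proof.
  intros Heps; assert (HL := pow2_ge_0 L).
  set (tau := eps / (4 + 188 * L ^ 2)).
  assert (HtauL : tau * (4 + 188 * L ^ 2) = eps) by (unfold tau; field; lra).
  assert (Htau : 0 < tau <= / 4).
  { split; [apply Rdiv_lt_0_compat; lra | nra]. }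
  set (s := tau * eps / 2).
  assert (Hs : 0 < s <= / 8) by (unfold s; split; [apply Rdiv_lt_0_compat; nra | nra]).
  set (K := (1 + / s) * tau ^ 2 * (72 * L ^ 2)).
  assert (HK : 0 <= K).
  { assert (0 < / s) by (apply Rinv_0_lt_compat; lra).
    assert (Htau2 := pow2_ge_0 tau); unfold K; apply Rmult_le_pos; [apply Rmult_le_pos|]; lra. }
  set (k := Rmin (/ 3) (s / (2 * (K + 1)))).
  assert (Hk0 : 0 < k) by (apply Rmin_glb_lt; [lra | apply Rdiv_lt_0_compat; lra]).
  assert (Hk3 : k <= / 3) by apply Rmin_l.
  assert (HkK : K * k ^ 2 <= s / 2).
  { assert (Hk : k <= s / (2 * (K + 1))) by apply Rmin_r.
    apply Rle_div_r in Hk; nra. }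
  exists tau, k, (1 - s / 4); split; [lra|]; split; [exact Hk0|]; split; [nra|].
  split; [lra|]; intros b d F P v v' w w' Hd Hv Hw Hsrc [Hb [Henergy Hsup]].
  split; [apply Rmult_le_pos; lra | split].
  - eapply Rle_trans; [apply (relax_energy eps tau L d F P); try assumption; lra|].
    replace (tau * eps) with (2 * s) by (unfold s; field).
    replace ((k * ((1 - s / 4) * b)) ^ 2) with ((1 - s / 4) ^ 2 * (k * b) ^ 2) by ring.
    apply Rle_trans with ((1 - 2 * s) * (k * b) ^ 2);
      [apply Rmult_le_compat_l; lra | apply Rmult_le_compat_r; [apply pow2_ge_0 | nra]].
  - intros x; eapply Rle_trans;
      [apply (relax_derivatives eps tau L d F P); try assumption; lra|]; fold s; fold K.
    assert (HE : K * mean (energy d) <= K * (k * b) ^ 2) by (apply Rmult_le_compat_l; lra).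
    assert (HEb : K * k ^ 2 * b ^ 2 <= s / 2 * b ^ 2)
      by (apply Rmult_le_compat_r; [apply pow2_ge_0 | exact HkK]).
    assert (Hderiv : (1 - s) * (d Ux x ^ 2 + d Mx x ^ 2) <= (1 - s) * b ^ 2)
      by (apply Rmult_le_compat_l; [lra | apply Hsup]).
    assert (0 <= s ^ 2 * b ^ 2) by (apply Rmult_le_pos; apply pow2_ge_0).
    rewrite Rpow_mult_distr in HE |- *; lra.
Qed.

(** * Continuation of solutions *)

Section MeanFieldGame.

Variables (H H' H'' V : R -> R) (alpha : R).
Hypothesis Halpha : 0 < alpha.
Hypothesis dH : has_derivative H H'.
Hypothesis dH' : has_derivative H' H''.
Hypothesis cH'' : continuity H''.
Hypothesis HV : C0T V.
Hypothesis H_tangent : forall p q, H p + H' p * (q - p) <= H q.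

Lemma H'_mono (p q : R) : 0 <= (H' p - H' q) * (p - q).
Proof. assert (Hpq := H_tangent p q); assert (Hqp := H_tangent q p); lra. Qed.

Definition admissible (z : state) : Prop := regular z /\ forall x, 0 < z M x.

Definition value_source (eps lam : R) (z : state) (x : R) : R :=
  Rpower (z M x) alpha - lam * (V x + H (z Ux x)) - (1 - lam) * (1 + eps).

Definition flux (lam : R) (z : state) (x : R) : R := lam * H' (z Ux x) * z M x.

Lemma value_source_C0T (eps lam : R) (z : state) : admissible z -> C0T (value_source eps lam z).
Proof. intros [[Hu Hm] Hpos]; unfold value_source; torus; apply Hpos. Qed.

Lemma flux_C0T (lam : R) (z : state) : admissible z -> C0T (flux lam z).
Proof. intros [[Hu Hm] _]; unfold flux; torus. Qed.

(* Problem 1 for [lam * H] and the potential [lam * V + (1 - lam) * (1 + eps)]. *)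
Definition solution (eps lam : R) (z : state) : Prop :=
  admissible z /\
  helmholtz (value_source eps lam z)
    (fun x => z U x - eps * z M x) (fun x => z Ux x - eps * z Mx x) /\
  helmholtz (flux lam z)
    (fun x => z Mx x + eps * z Ux x + flux lam z x) (fun x => z M x + eps * z U x - 1).

Definition trivial_state : state :=
  fun i _ => match i with M => 1 | U | Ux | Mx => 0 end.

Lemma trivial_solution (eps : R) : solution eps 0 trivial_state.
Proof.
  assert (C1T_const : forall c, C1T (fun _ => c) (fun _ => 0)).
  { intros c; split; [periodic | split; [intros x; derive; reflexivity | cont]]. }
  assert (Hsrc : value_source eps 0 trivial_state = fun _ => - eps).
  { extensionality x; unfold value_source, trivial_state, Rpower.
    rewrite ln_1, Rmult_0_r, exp_0; ring. }
  assert (Hflux : flux 0 trivial_state = fun _ => 0) by (extensionality x; unfold flux; ring).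
  split; [split; [split; apply C1T_const | intros; unfold trivial_state; lra]|].
  rewrite Hsrc, Hflux; unfold trivial_state; split; split;
    (split; [periodic | split; [intros x; derive; ring | cont]]).
Qed.

Definition defect (eps lam : R) (z : state) : state :=
  residual eps z (green (value_source eps lam z)) (green' (value_source eps lam z))
    (green (flux lam z)) (fun x => green' (flux lam z) x + 1) (flux lam z).

Lemma solution_defect (eps lam : R) (z : state) : solution eps lam z ->
  forall i x, defect eps lam z i x = 0.
Proof.
  intros [Hz [HF HP]] i x.
  destruct (helmholtz_unique _ _ _ _ _ HF (green_helmholtz _ (value_source_C0T eps lam z Hz)) x)
    as [EF EF'].
  destruct (helmholtz_unique _ _ _ _ _ HP (green_helmholtz _ (flux_C0T lam z Hz)) x) as [EP EP'].
  unfold defect, residual; destruct i; lra.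
Qed.

Lemma defect_solution (eps lam : R) (z : state) : admissible z ->
  (forall i x, defect eps lam z i x = 0) -> solution eps lam z.
Proof.
  intros Hz Hzero; split; [exact Hz | split].
  - replace (fun x => z U x - eps * z M x) with (green (value_source eps lam z)) by
      (extensionality x; specialize (Hzero M x); unfold defect, residual in Hzero; lra).
    replace (fun x => z Ux x - eps * z Mx x) with (green' (value_source eps lam z)) by
      (extensionality x; specialize (Hzero Mx x); unfold defect, residual in Hzero; lra).
    apply green_helmholtz, value_source_C0T, Hz.
  - replace (fun x => z Mx x + eps * z Ux x + flux lam z x) with (green (flux lam z)) by
      (extensionality x; specialize (Hzero Ux x); unfold defect, residual in Hzero; lra).
    replace (fun x => z M x + eps * z U x - 1) with (green' (flux lam z)) by
      (extensionality x; specialize (Hzero U x); unfold defect, residual in Hzero; lra).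
    apply green_helmholtz, flux_C0T, Hz.
Qed.

Lemma defect_difference (eps lam1 lam2 : R) (z1 z2 : state) : admissible z1 -> admissible z2 ->
  exists v v' w w',
    helmholtz (fun x => value_source eps lam1 z1 x - value_source eps lam2 z2 x) v v' /\
    helmholtz (fun x => flux lam1 z1 x - flux lam2 z2 x) w w' /\
    difference (defect eps lam1 z1) (defect eps lam2 z2)
    = residual eps (difference z1 z2) v v' w w' (fun x => flux lam1 z1 x - flux lam2 z2 x).
Proof.
  intros A1 A2; unfold defect; rewrite residual_difference.
  do 4 eexists; split; [|split; [|reflexivity]].
  - apply helmholtz_minus; apply green_helmholtz, value_source_C0T; assumption.
  - replace (fun x => green' (flux lam1 z1) x + 1 - (green' (flux lam2 z2) x + 1))
      with (fun x => green' (flux lam1 z1) x - green' (flux lam2 z2) x)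
      by (extensionality x; ring).
    apply helmholtz_minus; apply green_helmholtz, flux_C0T; assumption.
Qed.

Lemma defect_close (eps lam1 lam2 d e : R) (z1 z2 : state) : 0 < eps <= 1 ->
  admissible z1 -> admissible z2 -> close d z1 z2 ->
  (forall x, Rabs (value_source eps lam1 z1 x - value_source eps lam2 z2 x) <= e) ->
  (forall x, Rabs (flux lam1 z1 x - flux lam2 z2 x) <= e) ->
  close (2 * d + 4 * e) (defect eps lam1 z1) (defect eps lam2 z2).
Proof.
  intros Heps A1 A2 Hd HF HP i x.
  destruct (defect_difference eps lam1 lam2 z1 z2 A1 A2) as [v [v' [w [w' [Hv [Hw Heq]]]]]].
  change (Rabs (difference (defect eps lam1 z1) (defect eps lam2 z2) i x) <= 2 * d + 4 * e).
  rewrite Heq.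
  destruct (helmholtz_sup_bound _ v v' e x Hv HF) as [Bv Bv'].
  destruct (helmholtz_sup_bound _ w w' e x Hw HP) as [Bw Bw'].
  assert (Hscal : forall j, Rabs (eps * difference z1 z2 j x) <= d).
  { intros j; apply Rabs_unit_mult_le, Hd; lra. }
  assert (Hdiff : forall j, Rabs (difference z1 z2 j x) <= d) by (intros j; apply Hd).
  specialize (HF x); specialize (HP x).
  assert (BU := Hdiff U); assert (BM := Hdiff M); assert (BUx := Hdiff Ux);
    assert (BMx := Hdiff Mx).
  assert (SU := Hscal U); assert (SM := Hscal M); assert (SUx := Hscal Ux);
    assert (SMx := Hscal Mx).
  apply Rabs_le_between in Bv, Bv', Bw, Bw', HP, BU, BM, BUx, BMx, SU, SM, SUx, SMx.
  destruct i; unfold residual; apply Rabs_le_between; lra.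
Qed.

Definition in_box (dl B : R) (z : state) : Prop :=
  forall x, dl <= z M x <= B /\ Rabs (z Ux x) <= B.

Lemma in_box_close (dl B c : R) (z0 z : state) : c <= dl / 2 -> c <= 1 ->
  in_box dl B z0 -> close c z z0 -> in_box (dl / 2) (B + 1) z.
Proof.
  intros Hc Hc1 Hbox Hclose x; destruct (Hbox x) as [Hm Hp].
  assert (Cm := Hclose M x); assert (Cp := Hclose Ux x).
  apply Rabs_le_between in Hp, Cm, Cp; split; [lra | apply Rabs_le_between; lra].
Qed.

(* The vector field [(m^alpha - lam H p, lam m H' p)] is monotone because [m H p] is convex
   in [p] and linear in [m]. *)
Lemma source_mono (lam m1 m2 p1 p2 : R) : 0 <= lam -> 0 < m1 -> 0 < m2 ->
  0 <= (Rpower m1 alpha - Rpower m2 alpha - lam * (H p1 - H p2)) * (m1 - m2)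
       + (lam * H' p1 * m1 - lam * H' p2 * m2) * (p1 - p2).
Proof.
  intros Hlam Hm1 Hm2; assert (Hpow := Rpower_mono alpha m1 m2 ltac:(lra) Hm1 Hm2).
  assert (Hgap : forall m p q, 0 < m -> 0 <= lam * (m * (H q - (H p + H' p * (q - p))))).
  { intros m p q Hm; specialize (H_tangent p q); repeat apply Rmult_le_pos; lra. }
  assert (Hgap1 := Hgap m1 p1 p2 Hm1); assert (Hgap2 := Hgap m2 p2 p1 Hm2).
  lra.
Qed.

Lemma nonlinearity_lipschitz (dl B : R) : 0 < dl -> exists L, 0 <= L /\
  forall m1 m2 p1 p2, dl <= m1 <= B -> dl <= m2 <= B -> Rabs p1 <= B -> Rabs p2 <= B ->
    Rabs (Rpower m1 alpha - Rpower m2 alpha) <= L * Rabs (m1 - m2) /\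
    Rabs (H p1 - H p2) <= L * Rabs (p1 - p2) /\
    Rabs (m1 * (H' p1 - H' p2)) <= L * Rabs (p1 - p2) /\
    Rabs (H' p2) <= L.
Proof.
  intros Hdl.
  destruct (Rpower_lipschitz_on alpha dl B Hdl) as [La [HLa Lpow]].
  destruct (lipschitz_on H H' (- B) B) as [Lh [HLh LH]]; [intros; apply dH | intros; cont |].
  destruct (lipschitz_on H' H'' (- B) B) as [Lh' [HLh' LH']];
    [intros; apply dH' | intros; cont |].
  destruct (continuity_bounded_on H' (- B) B) as [K [HK KH']]; [intros; cont|].
  assert (HBL : 0 <= Rabs B * Lh') by (apply Rmult_le_pos; [apply Rabs_pos | exact HLh']).
  exists (La + Lh + Rabs B * Lh' + K); split; [lra | intros m1 m2 p1 p2 Hm1 Hm2 Hp1 Hp2].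
  apply Rabs_le_between in Hp1, Hp2.
  assert (Tm := Rabs_pos (m1 - m2)); assert (Tp := Rabs_pos (p1 - p2)).
  repeat split.
  - eapply Rle_trans; [apply Lpow; assumption | apply Rmult_le_compat_r; lra].
  - eapply Rle_trans; [apply LH; assumption | apply Rmult_le_compat_r; lra].
  - apply Rle_trans with (Rabs B * (Lh' * Rabs (p1 - p2))).
    + rewrite Rabs_mult, (Rabs_pos_eq m1), (Rabs_pos_eq B) by lra.
      apply Rmult_le_compat; [lra | apply Rabs_pos | lra | apply LH'; assumption].
    + rewrite <- Rmult_assoc; apply Rmult_le_compat_r; lra.
  - specialize (KH' p2 Hp2); lra.
Qed.

Lemma source_control_box (dl B : R) : 0 < dl -> exists L, 0 <= L /\
  forall eps lam z1 z2, 0 <= lam <= 1 -> in_box dl B z1 -> in_box dl B z2 ->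
    source_control L (difference z1 z2)
      (fun x => value_source eps lam z1 x - value_source eps lam z2 x)
      (fun x => flux lam z1 x - flux lam z2 x).
Proof.
  intros Hdl; destruct (nonlinearity_lipschitz dl B Hdl) as [L [HL Hlip]].
  exists L; split; [exact HL | intros eps lam z1 z2 Hlam Hbox1 Hbox2 x].
  destruct (Hbox1 x) as [Hm1 Hp1]; destruct (Hbox2 x) as [Hm2 Hp2].
  destruct (Hlip _ _ _ _ Hm1 Hm2 Hp1 Hp2) as [Lpow [LH [LH' KH']]].
  unfold value_source, flux, difference.
  set (m1 := z1 M x) in *; set (m2 := z2 M x) in *;
    set (p1 := z1 Ux x) in *; set (p2 := z2 Ux x) in *.
  assert (Hscal : forall t, Rabs (lam * t) <= Rabs t).
  { intros t; apply Rabs_unit_mult_le; lra. }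
  split; [|split].
  - replace (_ - _) with ((Rpower m1 alpha - Rpower m2 alpha) - lam * (H p1 - H p2)) by ring.
    eapply Rle_trans; [apply Rabs_triang|]; rewrite Rabs_Ropp.
    specialize (Hscal (H p1 - H p2)); lra.
  - eapply Rle_trans; [apply (source_mono lam m1 m2 p1 p2); lra | right; ring].
  - exists (lam * (m1 * (H' p1 - H' p2))), (lam * H' p2); split; [ring | split; [|split]].
    + replace (_ * _) with (lam * m1 * ((H' p1 - H' p2) * (p1 - p2))) by ring.
      apply Rmult_le_pos; [apply Rmult_le_pos; lra | apply H'_mono].
    + eapply Rle_trans; [apply Hscal | exact LH'].
    + eapply Rle_trans; [apply Hscal | exact KH'].
Qed.

Lemma defect_homotopy_bound (dl B : R) : exists Q, 0 < Q /\
  forall eps lam lam' z, 0 < eps <= 1 -> solution eps lam z -> in_box dl B z ->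
    forall i x, Rabs (defect eps lam' z i x) <= Q * Rabs (lam' - lam).
Proof.
  destruct (continuity_bounded_on H (- B) B) as [KH [HKH BH]]; [intros; cont|].
  destruct (continuity_bounded_on H' (- B) B) as [KH' [HKH' BH']]; [intros; cont|].
  destruct (C0T_bounded V HV) as [KV [HKV BV]].
  assert (HKB : 0 <= KH' * Rabs B) by (apply Rmult_le_pos; [assumption | apply Rabs_pos]).
  set (Q := 2 + KV + KH + KH' * Rabs B).
  exists (4 * Q); split; [unfold Q; lra|].
  intros eps lam lam' z Heps Hsol Hbox i x; assert (Hz := proj1 Hsol).
  rewrite <- (Rminus_0_r (defect eps lam' z i x)), <- (solution_defect eps lam z Hsol i x).
  replace (4 * Q * Rabs (lam' - lam)) with (2 * 0 + 4 * (Rabs (lam' - lam) * Q)) by ring.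
  apply defect_close; try assumption.
  - intros j y; rewrite Rminus_diag, Rabs_R0; lra.
  - intros y; destruct (Hbox y) as [_ Hp]; apply Rabs_le_between in Hp.
    specialize (BH _ Hp); specialize (BV y); apply Rabs_le_between in BH, BV.
    replace (_ - _) with ((lam' - lam) * (1 + eps - (V y + H (z Ux y))))
      by (unfold value_source; ring).
    rewrite Rabs_mult; apply Rmult_le_compat_l; [apply Rabs_pos|].
    apply Rabs_le_between; unfold Q; lra.
  - intros y; destruct (Hbox y) as [Hm Hp]; apply Rabs_le_between in Hp; specialize (BH' _ Hp).
    replace (_ - _) with ((lam' - lam) * (H' (z Ux y) * z M y)) by (unfold flux; ring).
    rewrite !Rabs_mult; apply Rmult_le_compat_l; [apply Rabs_pos|].
    apply Rle_trans with (KH' * Rabs B); [|unfold Q; lra].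
    assert (Hpos := proj2 Hz y).
    apply Rmult_le_compat; try apply Rabs_pos; [exact BH' | rewrite !Rabs_pos_eq; lra].
Qed.

Lemma relax_defect_regular (eps lam tau : R) (z : state) : admissible z ->
  regular (relax tau z (defect eps lam z)).
Proof.
  intros Hz; destruct (green_helmholtz _ (value_source_C0T eps lam z Hz)) as [GF GF'].
  destruct (green_helmholtz _ (flux_C0T lam z Hz)) as [GP GP'].
  destruct Hz as [[Hu Hm] _].
  unfold relax, defect, residual; split;
    (split; [periodic | split; [intros x; derive; ring | cont]]).
Qed.

Lemma relax_defect_lipschitz (eps lam tau L d : R) (z1 z2 : state) :
  0 < eps <= 1 -> 0 < tau <= 1 -> 0 <= L -> admissible z1 -> admissible z2 ->
  source_control L (difference z1 z2)
    (fun x => value_source eps lam z1 x - value_source eps lam z2 x)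
    (fun x => flux lam z1 x - flux lam z2 x) ->
  close d z1 z2 ->
  close ((3 + 8 * L) * d) (relax tau z1 (defect eps lam z1)) (relax tau z2 (defect eps lam z2)).
Proof.
  intros Heps Htau HL A1 A2 Hsrc Hd.
  assert (Hle : forall x, L * (Rabs (difference z1 z2 M x) + Rabs (difference z1 z2 Ux x))
                          <= 2 * L * d).
  { intros x; assert (Hm := Hd M x); assert (Hp := Hd Ux x); unfold difference.
    replace (2 * L * d) with (L * (d + d)) by ring; apply Rmult_le_compat_l; lra. }
  assert (Hdefect : close (2 * d + 4 * (2 * L * d)) (defect eps lam z1) (defect eps lam z2)).
  { apply defect_close; try assumption; intros x; eapply Rle_trans; [|apply Hle| |apply Hle].
    - apply Hsrc.
    - apply (source_control_flux _ _ _ _ x Hsrc). }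
  intros i x; specialize (Hd i x); specialize (Hdefect i x); unfold relax.
  replace (_ - _) with ((z1 i x - z2 i x) - tau * (defect eps lam z1 i x - defect eps lam z2 i x))
    by ring.
  apply (Rabs_unit_mult_le tau) in Hdefect; [|lra].
  eapply Rle_trans; [apply Rabs_triang|]; rewrite Rabs_Ropp; lra.
Qed.

Lemma continuation_step (eps dl B : R) : 0 < eps <= 1 -> 0 < dl -> exists eta, 0 < eta /\
  forall lam lam' z, 0 <= lam' <= 1 -> Rabs (lam' - lam) <= eta ->
    solution eps lam z -> in_box dl B z -> exists z', solution eps lam' z'.
Proof.
  intros Heps Hdl.
  destruct (source_control_box (dl / 2) (B + 1)) as [L [HL Hsrc]]; [lra|].
  destruct (relax_contraction eps L Heps) as [tau [k [q [Htau [Hk [Hk9 [Hq Hcontr]]]]]]].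
  destruct (defect_homotopy_bound dl B) as [Q [HQ Hdefect]].
  set (c := Rmin (dl / 2) 1).
  assert (Hc : 0 < c) by (apply Rmin_glb_lt; lra).
  exists (c * (1 - q) * k / (2 * Q)); split.
  { apply Rdiv_lt_0_compat; [repeat apply Rmult_lt_0_compat|]; lra. }
  intros lam lam' z0 Hlam' Hlam Hsol Hbox.
  assert (Hball : forall z, close c z z0 -> in_box (dl / 2) (B + 1) z).
  { intros z; apply in_box_close; [apply Rmin_l | apply Rmin_r | exact Hbox]. }
  assert (Hadm : forall z, regular z -> close c z z0 -> admissible z).
  { intros z Hz Hclose; split; [exact Hz | intros x; destruct (Hball z Hclose x); lra]. }
  destruct (local_fixed_point (fun z => relax tau z (defect eps lam' z)) (near k) c q
    (3 + 8 * L) z0) as [z [Hz [Hclose Hfixed]]].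
  - lra.
  - exact Hq.
  - apply Hsol.
  - intros d b; apply near_uniform_bound, Hk9.
  - intros z Hz Hclose; apply relax_defect_regular, Hadm; assumption.
  - intros z1 z2 b R1 R2 C1 C2 Hnear; rewrite relax_difference.
    destruct (defect_difference eps lam' lam' z1 z2) as [v [v' [w [w' [Hv [Hw ->]]]]]]; auto.
    eapply Hcontr; eauto using regular_difference.
  - intros z1 z2 d R1 R2 C1 C2; apply relax_defect_lipschitz; auto.
  - apply (uniform_bound_near k _ (Q * Rabs (lam' - lam))).
    + split; [exact Hk | nra].
    + apply Rle_div_r in Hlam; lra.
    + intros i; apply regular_C0T, regular_difference; [|apply Hsol].
      apply relax_defect_regular, Hsol.
    + intros i x; unfold difference, relax.
      replace (_ - _) with (- (tau * defect eps lam' z0 i x)) by ring.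
      rewrite Rabs_Ropp; apply Rabs_unit_mult_le; [lra|].
      apply (Hdefect eps lam lam' z0 Heps Hsol Hbox).
  - exists z; apply defect_solution; [apply Hadm; assumption | intros i x].
    specialize (Hfixed i x); unfold relax in Hfixed; apply (Rmult_eq_reg_l tau); lra.
Qed.

Lemma continuation (eps dl B : R) : 0 < eps <= 1 -> 0 < dl ->
  (forall lam z, 0 <= lam <= 1 -> solution eps lam z -> in_box dl B z) ->
  exists z, solution eps 1 z.
Proof.
  intros Heps Hdl Hbox; destruct (continuation_step eps dl B Heps Hdl) as [eta [Heta Hstep]].
  destruct (archimed_cor1 eta Heta) as [N [HN HN0]].
  assert (HNpos : 0 < INR N) by (apply lt_0_INR, HN0).
  assert (Hfrac : forall j, (j <= N)%nat -> 0 <= INR j / INR N <= 1).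
  { intros j Hj; apply le_INR in Hj; assert (Hj0 := pos_INR j); split.
    - apply Rdiv_le_0_compat; assumption.
    - apply Rle_div_l; lra. }
  assert (Hgrid : forall j, (j <= N)%nat -> exists z, solution eps (INR j / INR N) z).
  { induction j as [|j IH]; intros Hj.
    - exists trivial_state; replace (INR 0 / INR N) with 0 by (simpl; field; lra).
      apply trivial_solution.
    - destruct IH as [z Hz]; [lia|].
      apply (Hstep (INR j / INR N) (INR (S j) / INR N) z); [apply Hfrac, Hj | | exact Hz |].
      + replace (INR (S j) / INR N - INR j / INR N) with (/ INR N)
          by (rewrite S_INR; field; lra).
        rewrite Rabs_pos_eq; [lra | left; apply Rinv_0_lt_compat, HNpos].
      + apply (Hbox (INR j / INR N)); [apply Hfrac; lia | exact Hz]. }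
  destruct (Hgrid N (le_n N)) as [z Hz]; exists z.
  replace (INR N / INR N) with 1 in Hz by (field; lra); exact Hz.
Qed.

(** * A priori estimates *)

(* [p H'(p) - H(p)] is the Legendre transform of [H] at [H'(p)], here tested at [1] and [-1]. *)
Lemma legendre_bound (lam p : R) : 0 <= lam <= 1 ->
  lam * Rabs (H' p) <= lam * (p * H' p - H p) + (Rabs (H 1) + Rabs (H (-1))).
Proof.
  intros Hlam; assert (Hright := H_tangent p 1); assert (Hleft := H_tangent p (-1)).
  assert (Hright_le := Rle_abs (H 1)); assert (Hleft_le := Rle_abs (H (-1))).
  assert (Hright_pos := Rabs_pos (H 1)); assert (Hleft_pos := Rabs_pos (H (-1))).
  assert (Hbound : Rabs (H' p) <= (p * H' p - H p) + (Rabs (H 1) + Rabs (H (-1))))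
    by (apply Rabs_le_between; lra).
  apply (Rmult_le_compat_l lam) in Hbound; [|lra]; nra.
Qed.

Section IntegralEstimates.

Variables (C Vmax Kpow : R).
Hypothesis H_lower : forall p, - C <= H p.
Hypothesis HC : 0 <= C.
Hypothesis V_bound : forall x, Rabs (V x) <= Vmax.

Let legendre_offset : R := Rabs (H 1) + Rabs (H (-1)).
Let potential_sup : R := Vmax + 2.

Hypothesis HKpow : forall m, 0 < m ->
  Rpower m alpha + (legendre_offset + potential_sup + 1) * m <= / 2 * (Rpower m alpha * m) + Kpow.

Variables (eps lam : R) (z : state).
Hypothesis Heps : 0 < eps <= 1.
Hypothesis Hlam : 0 <= lam <= 1.
Hypothesis Hsol : solution eps lam z.

Let F : R -> R := value_source eps lam z.
Let P : R -> R := flux lam z.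

(* Obtained by testing the first equation with [m], the second with [u], and the first
   with [1]. *)
Lemma energy_identity :
  mean (fun x => F x * z M x + P x * z Ux x + eps * energy z x - (F x + eps * z M x)) = 0.
Proof.
  destruct Hsol as [Hz [HF HP]]; fold F in HF; fold P in HP.
  assert (CF := helmholtz_C0T _ _ _ HF); assert (CP := helmholtz_C0T _ _ _ HP).
  assert (Hmass := mean_derivative _ _ (proj2 HF)).
  destruct Hz as [[Hu Hm] _].
  assert (Htest_m := helmholtz_weak _ _ _ _ _ HF Hm).
  assert (Htest_u := mean_parts _ _ _ _ (proj1 HP) Hu).
  transitivity (0 + (0 + -1 * 0)); [|ring].
  rewrite <- Hmass at 1; rewrite <- Htest_u at 1; rewrite <- Htest_m.
  rewrite <- mean_mult_l, <- !mean_plus by cont.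
  apply mean_ext; intros x; unfold energy; ring.
Qed.

Definition energy_density (x : R) : R :=
  z M x * (lam * (z Ux x * H' (z Ux x) - H (z Ux x)) + legendre_offset)
  + / 2 * (Rpower (z M x) alpha * z M x) + (lam * H (z Ux x) + C).

Lemma legendre_nonneg (p : R) : 0 <= lam * (p * H' p - H p) + legendre_offset.
Proof.
  assert (Hleg := legendre_bound lam p Hlam); fold legendre_offset in Hleg.
  assert (0 <= lam * Rabs (H' p)) by (apply Rmult_le_pos; [lra | apply Rabs_pos]); lra.
Qed.

Lemma scaled_H_lower (p : R) : 0 <= lam * H p + C.
Proof. specialize (H_lower p); nra. Qed.

Lemma potential_bound (x : R) : Rabs (lam * V x + (1 - lam) * (1 + eps)) <= potential_sup.
Proof.
  specialize (V_bound x); apply Rabs_le_between in V_bound; apply Rabs_le_between.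
  unfold potential_sup; split; nra.
Qed.

Lemma energy_density_continuity : continuity energy_density.
Proof. destruct Hsol as [[[Hu Hm] Hpos] _]; unfold energy_density; cont; apply Hpos. Qed.

Lemma mean_energy_density_le : mean energy_density <= Kpow + potential_sup + C.
Proof.
  assert (Hc := energy_density_continuity).
  assert (CF := value_source_C0T eps lam z (proj1 Hsol)); fold F in CF.
  assert (CP := flux_C0T lam z (proj1 Hsol)); fold P in CP.
  assert (Hid := energy_identity); destruct Hsol as [[[Hu Hm] Hpos] _].
  rewrite <- (Rplus_0_r (Kpow + potential_sup + C)), <- Hid.
  rewrite <- (mean_const (Kpow + potential_sup + C)), <- mean_plus by (unfold energy; cont).
  apply mean_le; [exact Hc | unfold energy; cont | intros x].
  assert (Hv := potential_bound x); apply Rabs_le_between in Hv.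
  assert (HE := energy_nonneg z x); specialize (HKpow (z M x) (Hpos x)); specialize (Hpos x).
  assert (HeE : 0 <= eps * energy z x) by (apply Rmult_le_pos; lra).
  assert (Hm_v : z M x * (lam * V x + (1 - lam) * (1 + eps) + eps) <= z M x * (potential_sup + 1))
    by (apply Rmult_le_compat_l; lra).
  unfold energy_density, F, P, value_source, flux; lra.
Qed.

Lemma energy_density_parts_nonneg (x : R) :
  0 <= z M x * (lam * (z Ux x * H' (z Ux x) - H (z Ux x)) + legendre_offset) /\
  0 <= / 2 * (Rpower (z M x) alpha * z M x) /\ 0 <= lam * H (z Ux x) + C.
Proof.
  assert (Hpos := proj2 (proj1 Hsol) x); split; [|split; [|apply scaled_H_lower]].
  - apply Rmult_le_pos; [lra | apply legendre_nonneg].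
  - apply Rmult_le_pos; [lra|]; apply Rmult_le_pos; [left; apply exp_pos | lra].
Qed.

Lemma value_source_mean_abs :
  mean (fun x => Rabs (F x)) <= 2 * (Kpow + potential_sup + C) + (1 + potential_sup + C).
Proof.
  assert (Hc := energy_density_continuity); assert (Hmean := mean_energy_density_le).
  assert (CF := value_source_C0T eps lam z (proj1 Hsol)); fold F in CF.
  apply Rle_trans with (mean (fun x => 2 * energy_density x + (1 + potential_sup + C)));
    [|rewrite mean_plus, mean_mult_l, mean_const by cont; lra].
  apply mean_le; [cont | cont | intros x].
  destruct (energy_density_parts_nonneg x) as [Hmlegendre [Hmpow HlamH]].
  assert (Hv := potential_bound x); apply Rabs_le_between in Hv.
  assert (Hpow := Rpower_le_1_plus alpha (z M x) ltac:(lra) (proj2 (proj1 Hsol) x)).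
  assert (Hpos : 0 < Rpower (z M x) alpha) by apply exp_pos.
  apply Rabs_le_between; unfold F, value_source, energy_density; split; lra.
Qed.

Lemma flux_mean_abs : mean (fun x => Rabs (P x)) <= Kpow + potential_sup + C.
Proof.
  assert (Hc := energy_density_continuity).
  assert (CP := flux_C0T lam z (proj1 Hsol)); fold P in CP.
  apply Rle_trans with (mean energy_density); [|apply mean_energy_density_le].
  apply mean_le; [cont | exact Hc | intros x].
  destruct (energy_density_parts_nonneg x) as [_ [Hmpow HlamH]].
  assert (Hpos := proj2 (proj1 Hsol) x).
  assert (Hleg := legendre_bound lam (z Ux x) Hlam); fold legendre_offset in Hleg.
  unfold P, flux; rewrite !Rabs_mult, (Rabs_pos_eq lam), (Rabs_pos_eq (z M x)) by lra.
  apply (Rmult_le_compat_l (z M x)) in Hleg; [|lra]; unfold energy_density; lra.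
Qed.

End IntegralEstimates.

Variable C : R.
Hypothesis H_lower : forall p, - C <= H p.

Lemma source_mean_abs_bound : exists S, 0 <= S /\
  forall eps lam z, 0 < eps <= 1 -> 0 <= lam <= 1 -> solution eps lam z ->
    mean (fun x => Rabs (value_source eps lam z x)) <= S /\
    mean (fun x => Rabs (flux lam z x)) <= S.
Proof.
  destruct (C0T_bounded V HV) as [Vmax [HVmax V_bound]].
  assert (Hright := Rabs_pos (H 1)); assert (Hleft := Rabs_pos (H (-1))).
  assert (HC := Rabs_pos C); set (potential_sup := Vmax + 2).
  destruct (Rpower_absorb alpha (Rabs (H 1) + Rabs (H (-1)) + potential_sup + 1))
    as [Kpow [HKpow Habsorb]]; [exact Halpha | unfold potential_sup; lra |].
  assert (H_lower' : forall p, - Rabs C <= H p).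
  { intros p; specialize (H_lower p); assert (HCle := Rle_abs C); lra. }
  exists (2 * (Kpow + potential_sup + Rabs C) + (1 + potential_sup + Rabs C)).
  split; [unfold potential_sup; lra|].
  intros eps lam z Heps Hlam Hsol; split.
  - apply value_source_mean_abs; assumption.
  - assert (Hflux := flux_mean_abs (Rabs C) Vmax Kpow H_lower' HC V_bound Habsorb eps lam z
      Heps Hlam Hsol).
    unfold potential_sup; lra.
Qed.

Lemma solution_flux_bound : exists S, 0 <= S /\
  forall eps lam z, 0 < eps <= 1 -> 0 <= lam <= 1 -> solution eps lam z -> forall x,
    Rabs (z U x - eps * z M x) <= S /\ Rabs (z M x + eps * z U x - 1) <= S /\
    Rabs (z Ux x - eps * z Mx x) <= S /\ Rabs (z Mx x + eps * z Ux x + flux lam z x) <= S.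
Proof.
  destruct source_mean_abs_bound as [S [HS Hmean]].
  exists (3 * S); split; [lra | intros eps lam z Heps Hlam Hsol x].
  destruct (Hmean eps lam z Heps Hlam Hsol) as [MF MP]; destruct Hsol as [_ [HF HP]].
  destruct (helmholtz_bound _ _ _ x HF), (helmholtz_bound _ _ _ x HP); lra.
Qed.

(* Eliminating [r] leaves an equation for [p] with a monotone nonlinearity. *)
Lemma slope_bound (eps lam m p r B S : R) : 0 < eps <= 1 -> 0 <= lam <= 1 -> 0 <= m <= B ->
  Rabs (p - eps * r) <= S -> Rabs (r + eps * p + lam * H' p * m) <= S ->
  Rabs p <= 2 * S + B * Rabs (H' 0).
Proof.
  intros Heps Hlam Hm Hpr Hflux; set (g := r + eps * p + lam * H' p * m) in *.
  apply (Rabs_unit_mult_le eps) in Hflux; [|lra].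
  assert (Hsum := Rabs_triang (p - eps * r) (eps * g)).
  assert (Hcoef : 0 <= eps * lam * m <= B).
  { assert (0 <= eps * lam <= 1) by nra; split; [apply Rmult_le_pos; lra | nra]. }
  assert (Hp : Rabs p <= Rabs (p - eps * r + eps * g) + eps * lam * m * Rabs (H' 0)).
  { apply (monotone_equation_bound H' (1 + eps ^ 2));
      [exact H'_mono | nra | lra | unfold g; ring]. }
  assert (eps * lam * m * Rabs (H' 0) <= B * Rabs (H' 0))
    by (apply Rmult_le_compat_r; [apply Rabs_pos | lra]).
  lra.
Qed.

Lemma solution_sup_bound : exists B, 1 <= B /\
  forall eps lam z, 0 < eps <= 1 -> 0 <= lam <= 1 -> solution eps lam z ->
    forall i x, Rabs (z i x) <= B.
Proof.
  destruct solution_flux_bound as [S [HS Hbound]].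
  set (Bm := 2 * S + 1); set (Bp := 2 * S + Bm * Rabs (H' 0)).
  assert (HBm : 1 + 2 * S <= Bm) by (unfold Bm; lra).
  assert (HBp : 2 * S <= Bp).
  { assert (0 <= Bm * Rabs (H' 0)) by (apply Rmult_le_pos; [lra | apply Rabs_pos]).
    unfold Bp; lra. }
  destruct (continuity_bounded_on H' (- Bp) Bp) as [KH' [HKH' BH']]; [intros; cont|].
  assert (HKB : 0 <= KH' * Bm) by (apply Rmult_le_pos; lra).
  exists (Bm + Bp + S + KH' * Bm); split; [lra|].
  intros eps lam z Heps Hlam Hsol i x.
  destruct (Hbound eps lam z Heps Hlam Hsol x) as [Bw [Bn [Bw' Bg]]].
  assert (Hpos := proj2 (proj1 Hsol) x); unfold flux in Bg.
  destruct (rotation_scaling_bound eps (z U x) (z M x) S (S + 1)) as [Bu Bm'];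
    [lra | exact Bw | |].
  { apply Rabs_le_between in Bn; apply Rabs_le_between; lra. }
  assert (Hm := Bm'); rewrite Rabs_pos_eq in Hm by lra.
  assert (Hp : Rabs (z Ux x) <= Bp)
    by (apply (slope_bound eps lam (z M x) (z Ux x) (z Mx x)); try assumption; lra).
  assert (HH' : Rabs (lam * H' (z Ux x) * z M x) <= KH' * Bm).
  { rewrite Rabs_mult, (Rabs_pos_eq (z M x)) by lra.
    apply Rmult_le_compat; [apply Rabs_pos | lra | | lra].
    apply Rabs_unit_mult_le, BH', Rabs_le_between; assumption. }
  assert (Hr : Rabs (z Mx x) <= S + Bp + KH' * Bm).
  { assert (Hep := Rabs_unit_mult_le eps _ _ ltac:(lra) Hp).
    apply Rabs_le_between in Bg, Hep, HH'; apply Rabs_le_between; lra. }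
  destruct i; lra.
Qed.

(* [uxx] and [mxx] are obtained by differentiating the two equations
   [u_x - eps m_x = v'] and [m_x + eps u_x + lam m H'(u_x) = w] and solving for [u_xx], [m_xx]. *)
Definition curvature_factor (eps lam : R) (z : state) (x : R) : R :=
  1 + eps ^ 2 + eps * lam * z M x * H'' (z Ux x).

Definition uxx (eps lam : R) (z : state) (x : R) : R :=
  (z U x - eps * z M x - value_source eps lam z x + eps * (z M x + eps * z U x - 1)
   - eps * lam * z Mx x * H' (z Ux x)) / curvature_factor eps lam z x.

Definition mxx (eps lam : R) (z : state) (x : R) : R :=
  z M x + eps * z U x - 1 - eps * uxx eps lam z x
  - lam * (H'' (z Ux x) * uxx eps lam z x * z M x + H' (z Ux x) * z Mx x).

Lemma curvature_factor_ge_1 (eps lam : R) (z : state) (x : R) : 0 <= eps -> 0 <= lam ->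
  admissible z -> 1 <= curvature_factor eps lam z x.
Proof.
  intros Heps Hlam [_ Hpos]; unfold curvature_factor; specialize (Hpos x).
  assert (Hconv := monotone_derivative_nonneg H' (z Ux x) _ H'_mono (dH' (z Ux x))).
  assert (0 <= eps * lam * z M x * H'' (z Ux x)) by (repeat apply Rmult_le_pos; lra).
  nra.
Qed.

Lemma Ux_has_derivative (eps lam : R) (z : state) : 0 <= eps -> 0 <= lam ->
  solution eps lam z -> has_derivative (z Ux) (uxx eps lam z).
Proof.
  intros Heps Hlam [[[Hu Hm] Hpos] [[_ HF] [HP _]]] x.
  unfold uxx, curvature_factor.
  apply (implicit_derivative H' (z Ux) (fun y => eps * lam * z M y)
    (fun y => (z Ux y - eps * z Mx y) + eps * (z Mx y + eps * z Ux y + flux lam z y))).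
  - nra.
  - exact H'_mono.
  - intros y; specialize (Hpos y); repeat apply Rmult_le_pos; lra.
  - intros y; unfold flux; ring.
  - cont.
  - apply dH'.
  - derive; ring.
  - destruct HF as [_ [HF _]], HP as [_ [HP _]].
    apply (derivable_pt_lim_plus (fun y => z Ux y - eps * z Mx y)); [apply HF|].
    apply (derivable_pt_lim_scal (fun y => z Mx y + eps * z Ux y + flux lam z y)), HP.
Qed.

Lemma Mx_has_derivative (eps lam : R) (z : state) : 0 <= eps -> 0 <= lam ->
  solution eps lam z -> has_derivative (z Mx) (mxx eps lam z).
Proof.
  intros Heps Hlam Hsol x; assert (DUx := Ux_has_derivative eps lam z Heps Hlam Hsol).
  destruct Hsol as [[[Hu Hm] _] [_ [[_ [HP _]] _]]].
  apply (derivable_pt_lim_ext (fun y => (z Mx y + eps * z Ux y + flux lam z y)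
    - (eps * z Ux y + lam * (H' (z Ux y) * z M y)))).
  { intros y; unfold flux; ring. }
  set (g := fun y => z Mx y + eps * z Ux y + flux lam z y) in *.
  change (derivable_pt_lim (fun y => g y - (eps * z Ux y + lam * (H' (z Ux y) * z M y))) x
    (mxx eps lam z x)).
  derive; unfold mxx; ring.
Qed.

Lemma value_source_bound (B : R) : exists K, 0 <= K /\
  forall eps lam z, 0 < eps <= 1 -> 0 <= lam <= 1 -> admissible z ->
    (forall i x, Rabs (z i x) <= B) -> forall x, Rabs (value_source eps lam z x) <= K.
Proof.
  destruct (continuity_bounded_on H (- B) B) as [KH [HKH BH]]; [intros; cont|].
  destruct (C0T_bounded V HV) as [KV [HKV BV]].
  assert (HpowB : 0 < Rpower B alpha) by apply exp_pos.
  exists (Rpower B alpha + (KV + KH) + 2); split; [lra | intros eps lam z Heps Hlam Hz Hsup x].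
  assert (Bm := Hsup M x); assert (Bp := Hsup Ux x); apply Rabs_le_between in Bp.
  specialize (BH _ Bp); specialize (BV x).
  assert (Hpos := proj2 Hz x); rewrite Rabs_pos_eq in Bm by lra.
  assert (Hpow : Rpower (z M x) alpha <= Rpower B alpha) by (apply Rle_Rpower_l; lra).
  assert (Hpow0 : 0 < Rpower (z M x) alpha) by apply exp_pos.
  assert (BVH : Rabs (lam * (V x + H (z Ux x))) <= KV + KH).
  { apply Rabs_unit_mult_le; [lra|]; assert (Htri := Rabs_triang (V x) (H (z Ux x))); lra. }
  assert (0 <= (1 - lam) * (1 + eps) <= 2) by nra.
  apply Rabs_le_between in BVH; apply Rabs_le_between; unfold value_source; lra.
Qed.

Lemma uxx_bound (B : R) : 1 <= B -> exists D, 0 <= D /\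
  forall eps lam z, 0 < eps <= 1 -> 0 <= lam <= 1 -> admissible z ->
    (forall i x, Rabs (z i x) <= B) -> forall x, Rabs (uxx eps lam z x) <= D.
Proof.
  intros HB.
  destruct (value_source_bound B) as [KF [HKF Bsource]].
  destruct (continuity_bounded_on H' (- B) B) as [KH' [HKH' BH']]; [intros; cont|].
  assert (HBK : 0 <= B * KH') by (apply Rmult_le_pos; lra).
  exists (4 * B + KF + 1 + B * KH'); split; [lra|].
  intros eps lam z Heps Hlam Hz Hsup x.
  assert (Bu := Hsup U x); assert (Bm := Hsup M x); assert (Bp := Hsup Ux x);
    assert (Br := Hsup Mx x); apply Rabs_le_between in Bp.
  specialize (BH' _ Bp); assert (Bsrc := Bsource eps lam z Heps Hlam Hz Hsup x).
  assert (Hunit : forall y r, Rabs y <= r -> Rabs (eps * y) <= r)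
    by (intros y r; apply Rabs_unit_mult_le; lra).
  assert (Bmass : Rabs (eps * (z M x + eps * z U x - 1)) <= 2 * B + 1).
  { apply Hunit; assert (Beu := Hunit _ _ Bu).
    apply Rabs_le_between in Bm, Beu; apply Rabs_le_between; lra. }
  assert (BrH : Rabs (eps * lam * z Mx x * H' (z Ux x)) <= B * KH').
  { rewrite !Rmult_assoc; apply Hunit, Rabs_unit_mult_le; [lra|].
    rewrite Rabs_mult; apply Rmult_le_compat; try apply Rabs_pos; assumption. }
  assert (Bem := Hunit _ _ Bm).
  assert (Hden := curvature_factor_ge_1 eps lam z x ltac:(lra) ltac:(lra) Hz).
  unfold uxx; rewrite Rabs_div, (Rabs_pos_eq (curvature_factor _ _ _ _)) by lra.
  apply Rle_div_l; [lra|].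
  apply Rle_trans with (4 * B + KF + 1 + B * KH').
  - apply Rabs_le_between in Bu, Bsrc, Bmass, BrH, Bem; apply Rabs_le_between; lra.
  - assert (0 <= 4 * B + KF + 1 + B * KH') by lra; nra.
Qed.

Lemma density_lower_bound (eps lam D K : R) (z : state) : 0 < eps <= 1 -> 0 <= lam <= 1 ->
  solution eps lam z -> eps * D <= / 2 ->
  (forall x, Rabs (z U x - uxx eps lam z x) <= D) ->
  (forall x, Rabs (H'' (z Ux x) * uxx eps lam z x) <= K) ->
  forall x, / (2 * (1 + K)) <= z M x.
Proof.
  intros Heps Hlam Hsol HepsD HD HK x.
  assert (Dr := Mx_has_derivative eps lam z ltac:(lra) ltac:(lra) Hsol).
  destruct Hsol as [[[Hu Hm] Hpos] _].
  destruct (C0T_min_attained (z M) (C1T_C0T _ _ Hm)) as [x0 Hmin].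
  assert (Hr : z Mx x0 = 0) by (apply (derivable_pt_lim_at_min (z M) x0); [exact Hmin | apply Hm]).
  assert (Hmxx : 0 <= mxx eps lam z x0)
    by (apply (derivable_pt_lim2_at_min (z M) (z Mx) x0); [exact Hmin | apply Hm | apply Dr]).
  unfold mxx in Hmxx; rewrite Hr in Hmxx.
  specialize (HD x0); specialize (HK x0); specialize (Hmin x); specialize (Hpos x0).
  apply (Rabs_unit_mult_le lam) in HK; [|exact Hlam].
  apply Rabs_le_between in HD, HK.
  assert (Hsrc : eps * (z U x0 - uxx eps lam z x0) <= eps * D)
    by (apply Rmult_le_compat_l; lra).
  assert (Hconv : z M x0 * - (lam * (H'' (z Ux x0) * uxx eps lam z x0)) <= z M x0 * K)
    by (apply Rmult_le_compat_l; lra).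
  apply Rle_trans with (z M x0); [|exact Hmin].
  apply (Rmult_le_reg_r (2 * (1 + K))); [lra|]; rewrite Rinv_l by lra; lra.
Qed.

Lemma solution_in_box : exists eps0 dl B, 0 < eps0 /\ 0 < dl /\
  forall eps lam z, 0 < eps <= 1 -> eps < eps0 -> 0 <= lam <= 1 -> solution eps lam z ->
    in_box dl B z.
Proof.
  destruct solution_sup_bound as [B [HB Hsup]].
  destruct (uxx_bound B HB) as [D [HD Huxx]].
  destruct (continuity_bounded_on H'' (- B) B) as [K [HK BH'']]; [intros; cont|].
  assert (HKD : 0 <= K * D) by (apply Rmult_le_pos; assumption).
  exists (/ (2 * (B + D))), (/ (2 * (1 + K * D))), B.
  split; [apply Rinv_0_lt_compat; lra|]; split; [apply Rinv_0_lt_compat; lra|].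
  intros eps lam z Heps Heps0 Hlam Hsol x.
  specialize (Hsup eps lam z Heps Hlam Hsol).
  specialize (Huxx eps lam z Heps Hlam (proj1 Hsol) Hsup).
  split; [split | apply Hsup].
  - apply (density_lower_bound eps lam (B + D) (K * D) z); try assumption.
    + apply (Rmult_lt_compat_r (2 * (B + D))) in Heps0; [|lra].
      rewrite Rinv_l in Heps0 by lra; lra.
    + intros y; eapply Rle_trans; [apply Rabs_triang|]; rewrite Rabs_Ropp.
      apply Rplus_le_compat; [apply Hsup | apply Huxx].
    + intros y; rewrite Rabs_mult; apply Rmult_le_compat; try apply Rabs_pos;
        [apply BH'', Rabs_le_between, Hsup | apply Huxx].
  - eapply Rle_trans; [apply Rle_abs | apply Hsup].
Qed.

Lemma solution_exists : exists eps0, 0 < eps0 /\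
  forall eps, 0 < eps <= 1 -> eps < eps0 -> exists z, solution eps 1 z.
Proof.
  destruct solution_in_box as [eps0 [dl [B [Heps0 [Hdl Hbox]]]]].
  exists eps0; split; [exact Heps0 | intros eps Heps Hlt].
  apply (continuation eps dl B Heps Hdl); intros lam z Hlam; apply Hbox; assumption.
Qed.

(** * Regularity of solutions *)

Hypothesis V_C1 : C1R V.
Hypothesis H''_C1 : C1R H''.

Lemma solution_Ux_C1T (eps lam : R) (z : state) : 0 <= eps -> 0 <= lam -> solution eps lam z ->
  C1T (z Ux) (uxx eps lam z).
Proof.
  intros Heps Hlam Hsol; assert (Dp := Ux_has_derivative eps lam z Heps Hlam Hsol).
  assert (CF := value_source_C0T eps lam z (proj1 Hsol)).
  assert (Hden := fun x => curvature_factor_ge_1 eps lam z x Heps Hlam (proj1 Hsol)).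
  destruct Hsol as [[[Hu Hm] _] _].
  split; [apply (C1T_derivative _ _ Hu) | split; [exact Dp|]].
  unfold uxx, curvature_factor in *; cont; specialize (Hden x); lra.
Qed.

Lemma solution_Mx_C1T (eps lam : R) (z : state) : 0 <= eps -> 0 <= lam -> solution eps lam z ->
  C1T (z Mx) (mxx eps lam z).
Proof.
  intros Heps Hlam Hsol; assert (Dr := Mx_has_derivative eps lam z Heps Hlam Hsol).
  assert (Hp := solution_Ux_C1T eps lam z Heps Hlam Hsol).
  destruct Hsol as [[[Hu Hm] _] _].
  split; [apply (C1T_derivative _ _ Hm) | split; [exact Dr | unfold mxx; cont]].
Qed.

Lemma solution_uxx_C1R (eps lam : R) (z : state) : 0 <= eps -> 0 <= lam -> solution eps lam z ->
  C1R (uxx eps lam z).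
Proof.
  intros Heps Hlam Hsol.
  assert (Hp := solution_Ux_C1T eps lam z Heps Hlam Hsol).
  assert (Hr := solution_Mx_C1T eps lam z Heps Hlam Hsol).
  assert (H_C1 : C1R H) by (exists H'; split; [exact dH | cont]).
  assert (H'_C1 : C1R H') by (exists H''; split; assumption).
  assert (Hden := fun x => curvature_factor_ge_1 eps lam z x Heps Hlam (proj1 Hsol)).
  destruct Hsol as [[[Hu Hm] Hpos] _].
  unfold uxx, curvature_factor, value_source in *; C1_regular; [exact Hpos|].
  intros x; specialize (Hden x); lra.
Qed.

Lemma solution_C2halfT (eps lam : R) (z : state) : 0 <= eps -> 0 <= lam -> solution eps lam z ->
  C2halfT (z U) (z Ux) (uxx eps lam z) /\ C2halfT (z M) (z Mx) (mxx eps lam z).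
Proof.
  intros Heps Hlam Hsol.
  assert (Hp := solution_Ux_C1T eps lam z Heps Hlam Hsol).
  assert (Hr := solution_Mx_C1T eps lam z Heps Hlam Hsol).
  assert (Huxx := solution_uxx_C1R eps lam z Heps Hlam Hsol).
  assert (H'_C1 : C1R H') by (exists H''; split; assumption).
  destruct Hsol as [[[Hu Hm] _] _].
  split; apply C2halfT_of_C1R; try assumption; unfold mxx; C1_regular.
Qed.

Lemma solution_Problem1 (eps : R) (z : state) : 0 <= eps -> solution eps 1 z ->
  Problem1 H H' V alpha eps (z U) (z Ux) (uxx eps 1 z) (z M) (z Mx) (mxx eps 1 z).
Proof.
  intros Heps Hsol; destruct (solution_C2halfT eps 1 z Heps ltac:(lra) Hsol) as [[Cu _] [Cm _]].
  assert (Hp := solution_Ux_C1T eps 1 z Heps ltac:(lra) Hsol).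
  assert (Hr := solution_Mx_C1T eps 1 z Heps ltac:(lra) Hsol).
  destruct Hsol as [[[_ Hm] Hpos] [[_ [_ [HF _]]] _]].
  split; [exact Cu | split; [exact Cm | split; [exact Hpos | split]]].
  - intros x.
    assert (Heq : uxx eps 1 z x - eps * mxx eps 1 z x
                  = z U x - eps * z M x - value_source eps 1 z x).
    { apply (uniqueness_limite (fun y => z Ux y - eps * z Mx y) x); [|apply HF].
      clear HF; derive; ring. }
    unfold value_source in Heq; lra.
  - exists (fun x => H'' (z Ux x) * uxx eps 1 z x * z M x + H' (z Ux x) * z Mx x); split.
    + intros x; derive; ring.
    + intros x; unfold mxx; ring.
Qed.

Lemma Problem1_solvable : exists eps0, 0 < eps0 /\
  forall eps, 0 < eps < eps0 -> eps <= 1 -> exists u u1 u2 m m1 m2,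
    Problem1 H H' V alpha eps u u1 u2 m m1 m2 /\
    C2halfT u u1 u2 /\ C2halfT m m1 m2 /\ (forall x, 0 < m x).
Proof.
  destruct solution_exists as [eps0 [Heps0 Hexists]].
  exists eps0; split; [exact Heps0 | intros eps Heps Heps1].
  destruct (Hexists eps) as [z Hz]; [lra | lra |].
  destruct (solution_C2halfT eps 1 z) as [Hu Hm]; [lra | lra | exact Hz |].
  do 6 eexists; split; [apply (solution_Problem1 eps z); [lra | exact Hz]|].
  split; [exact Hu | split; [exact Hm | apply Hz]].
Qed.

End MeanFieldGame.

Lemma powabs_nonneg (p g : R) : 0 <= powabs p g.
Proof. unfold powabs; destruct (Req_EM_T p 0); [lra | left; apply exp_pos]. Qed.

Theorem theorem1
  (H H1 H2 H3 H4 V V1 V2 : R -> R)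
  (alpha gamma C1 C2 C3 Ct1 Ct2 Ct3 Cbar : R)
  (* (A5), which includes H in C^2; H1 = H' *)
  (hH : C4R H H1 H2 H3 H4)
  (* (A3) V in C^2(T) (in particular continuous and 1-periodic) *)
  (hV : C2T V V1 V2)
  (halpha : 0 < alpha)
  (* (A1) *)
  (hC1 : 0 < C1) (hC2 : 0 < C2) (hC3 : 0 < C3) (hgamma : 1 < gamma)
  (hA1 : forall p, - C1 + C2 * powabs p gamma <= H p <= C1 + C3 * powabs p gamma)
  (* (A2) *)
  (hCt1 : 0 < Ct1) (hCt2 : 0 < Ct2) (hCt3 : 0 < Ct3)
  (hA2 : forall p, - Ct1 + Ct2 * powabs p gamma <= p * H1 p - H p
                   <= Ct1 + Ct3 * powabs p gamma)
  (* (A4) *)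
  (hA4 : convex H)
  (* (A6) *)
  (hA6 : gamma < 2)
  (* (A7) *)
  (hCbar : 0 < Cbar)
  (hA7 : forall p, Rabs (H1 p) <= Cbar * (1 + powabs p (gamma - 1))) :
  exists eps0, 0 < eps0 /\
    forall eps, 0 < eps < eps0 -> eps <= 1 ->
      exists u u1 u2 m m1 m2 : R -> R,
        Problem1 H H1 V alpha eps u u1 u2 m m1 m2 /\
        C2halfT u u1 u2 /\ C2halfT m m1 m2 /\ (forall x, 0 < m x).
Proof.
  destruct hH as [dH [dH1 [dH2 [dH3 _]]]], hV as [PV [dV [dV1 _]]].
  assert (cV1 := has_derivative_continuity V1 V2 dV1).
  assert (cH2 := has_derivative_continuity H2 H3 dH2).
  assert (cH3 := has_derivative_continuity H3 H4 dH3).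
  apply (Problem1_solvable H H1 H2 V alpha halpha dH dH1 cH2) with (C := C1).
  - split; [exact PV | exact (has_derivative_continuity V V1 dV)].
  - exact (convex_tangent H H1 hA4 dH).
  - intros p; assert (0 <= C2 * powabs p gamma)
      by (apply Rmult_le_pos; [lra | apply powabs_nonneg]).
    specialize (hA1 p); lra.
  - exists V1; split; assumption.
  - exists H3; split; assumption.
Qed.
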